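(* Let $\mathcal{C}$ be a bicategory, $\mathcal{W}$ a family of arrows of $\mathcal{C}$ containing the identities, and $i:\mathcal{C}\to\mathcal{H}o(\mathcal{C},\mathcal{W})$ the canonical 2-functor. Then, for every bicategory $\mathcal{D}$, precomposing with $i$ establishes a biequivalence of bicategories, which in fact is an isomorphism of bicategories: $$\mathrm{Hom}_{(i\mathcal{W},\Theta)}(\mathcal{H}o(\mathcal{C},\mathcal{W}),\mathcal{D})\xrightarrow{\ i^*\ }\mathrm{Hom}_{(\mathcal{W},\Theta)}(\mathcal{C},\mathcal{D}).$$
   Context: **Conventions.** In a bicategory, $\circ$ is vertical composition of 2-cells and $*$ is horizontal composition ($g*f$ means first $f$, then $g$); an arrow also denotes its identity 2-cell, so $r*\alpha$ and $\alpha*\ell$ are whiskerings. By coherence, parentheses and identity arrows in horizontal composites of arrows are omitted, and associators and unitors are inserted tacitly. A pseudofunctor $F$ has invertible structural 2-cells $\phi:Fg*Ff\Rightarrow F(g*f)$ and $\xi:id_{FX}\Rightarrow F(id_X)$ satisfying the usual axioms (their inverses are denoted by the same letters). A 2-functor is a pseudofunctor between bicategories all of whose structural 2-cells $\phi,\xi$ are identities. An arrow $f:X\to Y$ is an equivalence if there are $g:Y\to X$ and invertible 2-cells $g*f\cong id_X$, $f*g\cong id_Y$; it is a quasiequivalence if for every object $Z$ the functors $f_*:\mathcal{C}(Z,X)\to\mathcal{C}(Z,Y)$ and $f^*:\mathcal{C}(Y,Z)\to\mathcal{C}(X,Z)$ are full and faithful. $\Theta$ and $\Theta_q$ denote the families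 of equivalences and of quasiequivalences of a bicategory. Writing $F:(\mathcal{C},\mathcal{W})\to(\mathcal{D},\Gamma)$ means that $F$ maps the arrows of $\mathcal{W}$ into $\Gamma$. **Cylinders and homotopies.** A cylinder for $X\in\mathcal{C}$ (with respect to $\mathcal{W}$) is $C=(W,Z,d_0,d_1,x,s,\alpha_0,\alpha_1)$ with $d_0,d_1:X\to W$, $x:X\to Z$, $s:W\to Z$ an arrow in $\mathcal{W}$, and invertible 2-cells $\alpha_0:s*d_0\Rightarrow x$, $\alpha_1:s*d_1\Rightarrow x$; put $\alpha=\alpha_1^{-1}\circ\alpha_0:s*d_0\Rightarrow s*d_1$. For $f,g:X\to Y$, a homotopy $H$ from $f$ to $g$ is $H=(C,h,\eta,\varepsilon)$ with $C$ a cylinder for $X$, $h:W\to Y$ an arrow, and 2-cells $\eta:f\Rightarrow h*d_0$, $\varepsilon:h*d_1\Rightarrow g$ (not necessarily invertible). For $r:Y\to Y'$, $r*H$ is the homotopy from $r*f$ to $r*g$ with the same cylinder, arrow $r*h$ and 2-cells $r*\eta$, $r*\varepsilon$. For $\ell:X'\to X$, $H*\ell$ is the homotopy from $f*\ell$ to $g*\ell$ with cylinder $(W,Z,d_0*\ell,d_1*\ell,x*\ell,s,\alpha_0*\ell,\alpha_1*\ell)$, arrow $h$ and 2-cells $\eta*\ell$, $\varepsilon*\ell$. **The 2-cells $\widehat{FH}$.** For a 2-functor $F:(\mathcal{C},\mathcal{W})\to(\mathcal{D},\Theta_q)$, let $\widehat{FC}:Fd_0\Rightarrow Fd_1$ be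 the unique (invertible) 2-cell with $Fs*\widehat{FC}=F\alpha$, and let $\widehat{FH}=F\varepsilon\circ(Fh*\widehat{FC})\circ F\eta:Ff\Rightarrow Fg$. For a 2-cell $\mu:f\Rightarrow g$ of $\mathcal{C}$, $I^\mu$ denotes any homotopy from $f$ to $g$ with $\widehat{FI^\mu}=F\mu$ for every such 2-functor $F$; for instance one may take the homotopy with cylinder $(X,X,id_X,id_X,id_X,id_X,id,id)$, $h=g$, $\eta=\mu$, $\varepsilon=id_g$ (modulo unitors). **$\mathcal{H}o(\mathcal{C},\mathcal{W})$ and $i$.** The objects, arrows, identity arrows and composition of arrows are those of $\mathcal{C}$. A 2-cell $f\Rightarrow g$ is a class $[H^n,\dots,H^1]$ of a finite sequence of composable homotopies ($H^1$ from $f$ to $f_1$, $H^2$ from $f_1$ to $f_2$, ..., $H^n$ from $f_{n-1}$ to $g$), where $[H^n,\dots,H^1]=[K^m,\dots,K^1]$ iff $\widehat{FH^n}\circ\cdots\circ\widehat{FH^1}=\widehat{FK^m}\circ\cdots\circ\widehat{FK^1}$ for every bicategory $\mathcal{D}$ and every 2-functor $F:(\mathcal{C},\mathcal{W})\to(\mathcal{D},\Theta_q)$. Vertical composition is juxtaposition of sequences; the identity 2-cell of $f$ is $[I^{id_f}]$; whiskerings are $r*[H^n,\dots,H^1]=[r*H^n,\dots,r*H^1]$ and $[H^n,\dots,H^1]*\ell=[H^n*\ell,\dots,H^1*\ell]$, and these determine the horizontal composition. The 2-functor $i:\mathcal{C}\to\mathcal{H}o(\mathcal{C},\mathcal{W})$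 is the identity on objects and arrows, and $i\mu=[I^\mu]$ on 2-cells; associators and unitors of $\mathcal{H}o(\mathcal{C},\mathcal{W})$ are the images under $i$ of those of $\mathcal{C}$. $i\mathcal{W}$ is the family of images under $i$ of the arrows of $\mathcal{W}$. **Hom bicategories.** $\mathrm{Hom}(\mathcal{C},\mathcal{D})$ is the bicategory of pseudofunctors, pseudonatural transformations and modifications; for a family $\Sigma$ of arrows of $\mathcal{C}$, $\mathrm{Hom}_{(\Sigma,\Theta)}(\mathcal{C},\mathcal{D})$ is its full subbicategory on the pseudofunctors mapping the arrows of $\Sigma$ to equivalences. A pseudofunctor $F$ is a biequivalence if there are a pseudofunctor $G$ in the opposite direction and pseudonatural transformations $GF\Rightarrow id$, $FG\Rightarrow id$ whose components are equivalences; it is an isomorphism if it has an inverse pseudofunctor (the composites $GF$, $FG$ being identities). *)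

(* Defs.v *)
From Stdlib Require Import ssreflect.
From Stdlib Require Import FunctionalExtensionality PropExtensionality
  ProofIrrelevance IndefiniteDescription.

Set Implicit Arguments.
Unset Strict Implicit.
Unset Printing Implicit Defensive.

Record bicat_data := BicatData {
  ob :> Type;
  hom : ob -> ob -> Type;
  cell : forall X Y : ob, hom X Y -> hom X Y -> Type;
  id1 : forall X : ob, hom X X;
  comp1 : forall X Y Z : ob, hom Y Z -> hom X Y -> hom X Z;
  id2 : forall (X Y : ob) (f : hom X Y), cell f f;
  vcomp : forall (X Y : ob) (f g h : hom X Y),
    cell g h -> cell f g -> cell f h;
  hcomp : forall (X Y Z : ob) (g g' : hom Y Z) (f f' : hom X Y),
    cell g g' -> cell f f' -> cell (comp1 g f) (comp1 g' f') }.

Arguments hom {_} X Y.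
Arguments cell {_ X Y} f g.
Arguments id1 {_} X.
Arguments comp1 {_ X Y Z} g f.
Arguments id2 {_ X Y} f.
Arguments vcomp {_ X Y f g h} b a : rename.
Arguments hcomp {_ X Y Z g g' f f'} b a : rename.

Declare Scope bicat_scope.
Delimit Scope bicat_scope with bicat.
Open Scope bicat_scope.

(* [g ⋅ f] : first [f], then [g].  [⋆] is the horizontal and [•] the vertical
   composition of 2-cells. *)
Notation "g ⋅ f" := (comp1 g f) (at level 40, left associativity) : bicat_scope.
Notation "b ⋆ a" := (hcomp b a) (at level 40, left associativity) : bicat_scope.
Notation "b • a" := (vcomp b a) (at level 45, right associativity) : bicat_scope.

Record iso2 (B : bicat_data) (X Y : B) (f g : hom X Y) := Iso2 {
  iso_fwd :> cell f g;
  iso_inv : cell g f;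
  iso_fwdK : iso_inv • iso_fwd = id2 f;
  iso_invK : iso_fwd • iso_inv = id2 g }.

Notation "a ^-1" := (iso_inv a) (at level 3, left associativity, format "a ^-1")
  : bicat_scope.

Record bicat := Bicat {
  bdata :> bicat_data;
  assoc : forall (X Y Z T : bdata) (h : hom Z T) (g : hom Y Z) (f : hom X Y),
    iso2 ((h ⋅ g) ⋅ f) (h ⋅ (g ⋅ f));
  lunit : forall (X Y : bdata) (f : hom X Y), iso2 (id1 Y ⋅ f) f;
  runit : forall (X Y : bdata) (f : hom X Y), iso2 (f ⋅ id1 X) f;
  vcompA : forall (X Y : bdata) (f g h k : hom X Y)
    (c : cell h k) (b : cell g h) (a : cell f g), c • (b • a) = (c • b) • a;
  vcomp1l : forall (X Y : bdata) (f g : hom X Y) (a : cell f g), id2 g • a = a;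
  vcomp1r : forall (X Y : bdata) (f g : hom X Y) (a : cell f g), a • id2 f = a;
  hcomp_id : forall (X Y Z : bdata) (g : hom Y Z) (f : hom X Y),
    id2 g ⋆ id2 f = id2 (g ⋅ f);
  hcomp_v : forall (X Y Z : bdata) (g g' g'' : hom Y Z) (f f' f'' : hom X Y)
    (b' : cell g' g'') (b : cell g g') (a' : cell f' f'') (a : cell f f'),
    (b' • b) ⋆ (a' • a) = (b' ⋆ a') • (b ⋆ a);
  assoc_nat : forall (X Y Z T : bdata) (h h' : hom Z T) (g g' : hom Y Z)
    (f f' : hom X Y) (c : cell h h') (b : cell g g') (a : cell f f'),
    assoc h' g' f' • ((c ⋆ b) ⋆ a) = (c ⋆ (b ⋆ a)) • assoc h g f;
  lunit_nat : forall (X Y : bdata) (f f' : hom X Y) (a : cell f f'),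
    lunit f' • (id2 (id1 Y) ⋆ a) = a • lunit f;
  runit_nat : forall (X Y : bdata) (f f' : hom X Y) (a : cell f f'),
    runit f' • (a ⋆ id2 (id1 X)) = a • runit f;
  pentagon : forall (X Y Z T U : bdata)
    (k : hom T U) (h : hom Z T) (g : hom Y Z) (f : hom X Y),
    assoc k h (g ⋅ f) • assoc (k ⋅ h) g f
    = (id2 k ⋆ assoc h g f) • (assoc k (h ⋅ g) f • (assoc k h g ⋆ id2 f));
  triangle : forall (X Y Z : bdata) (g : hom Y Z) (f : hom X Y),
    (id2 g ⋆ lunit f) • assoc g (id1 Y) f = runit g ⋆ id2 f }.

Arguments assoc {_ X Y Z T} h g f.
Arguments lunit {_ X Y} f.
Arguments runit {_ X Y} f.

(* Coherence: a 2-cell between composites of arrows is determined by its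
   strictified action on composable arrows, in which associators and unitors
   act as identities. *)

Section Coherence.
Variable B : bicat.

Lemma whl_v (X Y Z : B) (g : hom Y Z) (f f' f'' : hom X Y)
  (a' : cell f' f'') (a : cell f f') :
  id2 g ⋆ (a' • a) = (id2 g ⋆ a') • (id2 g ⋆ a).
Proof. by rewrite -hcomp_v vcomp1l. Qed.

Lemma whr_v (X Y Z : B) (g g' g'' : hom Y Z) (f : hom X Y)
  (b' : cell g' g'') (b : cell g g') :
  (b' • b) ⋆ id2 f = (b' ⋆ id2 f) • (b ⋆ id2 f).
Proof. by rewrite -hcomp_v vcomp1l. Qed.

Lemma hcomp_lr (X Y Z : B) (g g' : hom Y Z) (f f' : hom X Y)
  (b : cell g g') (a : cell f f') : b ⋆ a = (b ⋆ id2 f') • (id2 g ⋆ a).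
Proof. by rewrite -hcomp_v vcomp1l vcomp1r. Qed.

Lemma hcomp_rl (X Y Z : B) (g g' : hom Y Z) (f f' : hom X Y)
  (b : cell g g') (a : cell f f') : b ⋆ a = (id2 g' ⋆ a) • (b ⋆ id2 f).
Proof. by rewrite -hcomp_v vcomp1l vcomp1r. Qed.

Lemma iso_epi (X Y : B) (f g h : hom X Y) (i : iso2 f g) (a b : cell g h) :
  a • i = b • i -> a = b.
Proof.
by move=> E; rewrite -(vcomp1r a) -(vcomp1r b) -(iso_invK i) !vcompA E.
Qed.

Lemma iso_mono (X Y : B) (f g h : hom X Y) (i : iso2 g h) (a b : cell f g) :
  i • a = i • b -> a = b.
Proof.
by move=> E; rewrite -(vcomp1l a) -(vcomp1l b) -(iso_fwdK i) -!vcompA E.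
Qed.

Lemma iso_mvR (X Y : B) (f g h : hom X Y) (i : iso2 f g) (a : cell g h)
  (b : cell f h) : a • i = b -> a = b • i^-1.
Proof. by move=> <-; rewrite -vcompA iso_invK vcomp1r. Qed.

Lemma iso_mvL (X Y : B) (f g h : hom X Y) (i : iso2 g h) (a : cell f g)
  (b : cell f h) : i • a = b -> a = i^-1 • b.
Proof. by move=> <-; rewrite vcompA iso_fwdK vcomp1l. Qed.

Lemma wh1l_inj (X Y : B) (f g : hom X Y) (a b : cell f g) :
  id2 (id1 Y) ⋆ a = id2 (id1 Y) ⋆ b -> a = b.
Proof. by move=> E; apply: (@iso_epi _ _ _ _ _ (lunit f)); rewrite -!lunit_nat E. Qed.

Lemma wh1r_inj (X Y : B) (f g : hom X Y) (a b : cell f g) :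
  a ⋆ id2 (id1 X) = b ⋆ id2 (id1 X) -> a = b.
Proof. by move=> E; apply: (@iso_epi _ _ _ _ _ (runit f)); rewrite -!runit_nat E. Qed.

Lemma whl_inj_iso (X Y Z : B) (f f' g : hom X Y) (k : hom Y Z) (i : iso2 f f')
  (a b : cell f' g) :
  (id2 k ⋆ a) • (id2 k ⋆ i) = (id2 k ⋆ b) • (id2 k ⋆ i) ->
  id2 k ⋆ a = id2 k ⋆ b.
Proof.
move=> E; rewrite -(vcomp1r a) -(vcomp1r b) -(iso_invK i) !vcompA.
by rewrite ![id2 k ⋆ ((_ • _) • _)]whl_v 2!whl_v E.
Qed.

Lemma lunit_assoc (X Y Z : B) (g : hom Y Z) (f : hom X Y) :
  lunit (g ⋅ f) • assoc (id1 Z) g f = lunit g ⋆ id2 f.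
Proof.
apply: wh1l_inj; rewrite whl_v.
have hA : (assoc (id1 Z) (id1 Z) g ⋆ id2 f)
  • ((assoc (id1 Z) (id1 Z) g)^-1 ⋆ id2 f) = id2 _
  by rewrite -whr_v iso_invK hcomp_id.
have E : (id2 (id1 Z) ⋆ lunit (g ⋅ f)) • (id2 (id1 Z) ⋆ assoc (id1 Z) g f)
   • (assoc (id1 Z) (id1 Z ⋅ g) f • (assoc (id1 Z) (id1 Z) g ⋆ id2 f))
   = (id2 (id1 Z) ⋆ (lunit g ⋆ id2 f))
   • (assoc (id1 Z) (id1 Z ⋅ g) f • (assoc (id1 Z) (id1 Z) g ⋆ id2 f)).
  rewrite -pentagon vcompA triangle -hcomp_id -assoc_nat.
  by rewrite [RHS]vcompA -assoc_nat -vcompA -whr_v triangle.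
have {}E := f_equal (fun z => z • (((assoc (id1 Z) (id1 Z) g)^-1 ⋆ id2 f))) E.
rewrite /= -!vcompA hA !vcomp1r in E.
apply: (@iso_epi _ _ _ _ _ (assoc (id1 Z) (id1 Z ⋅ g) f)).
by rewrite -vcompA.
Qed.

Inductive wexpr : B -> B -> Type :=
| wat : forall X Y, hom X Y -> wexpr X Y
| wid : forall X, wexpr X X
| wcomp : forall X Y Z, wexpr Y Z -> wexpr X Y -> wexpr X Z.

Fixpoint ev X Y (e : wexpr X Y) : hom X Y :=
  match e with
  | wat f => f
  | wid X => id1 X
  | wcomp g f => ev g ⋅ ev f
  end.

Fixpoint act X Y (e : wexpr X Y) Z : hom Z X -> hom Z Y :=
  match e in wexpr X Y return hom Z X -> hom Z Y with
  | wat f => fun k => f ⋅ k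
  | wid _ => fun k => k
  | wcomp g f => fun k => act g (act f k)
  end.

Fixpoint actm X Y (e : wexpr X Y) Z :
  forall k k' : hom Z X, cell k k' -> cell (act e k) (act e k') :=
  match e in wexpr X Y return
    forall k k' : hom Z X, cell k k' -> cell (act e k) (act e k') with
  | wat f => fun k k' c => id2 f ⋆ c
  | wid _ => fun k k' c => c
  | wcomp g f => fun k k' c => actm g (actm f c)
  end.

Definition iso_id (X Y : B) (f : hom X Y) : iso2 f f :=
  @Iso2 B X Y f f (id2 f) (id2 f) (vcomp1l _) (vcomp1l _).

Definition iso_sym (X Y : B) (f g : hom X Y) (i : iso2 f g) : iso2 g f :=
  @Iso2 B X Y g f i^-1 i (iso_invK i) (iso_fwdK i).

Lemma comp_isoK (X Y : B) (f g h : hom X Y) (j : iso2 g h) (i : iso2 f g) :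
  (i^-1 • j^-1) • (j • i) = id2 f.
Proof. by rewrite -vcompA (vcompA j^-1) iso_fwdK vcomp1l iso_fwdK. Qed.

Lemma comp_isoVK (X Y : B) (f g h : hom X Y) (j : iso2 g h) (i : iso2 f g) :
  (j • i) • (i^-1 • j^-1) = id2 h.
Proof. by rewrite -vcompA (vcompA i) iso_invK vcomp1l iso_invK. Qed.

Definition iso_comp (X Y : B) (f g h : hom X Y) (j : iso2 g h) (i : iso2 f g) :
  iso2 f h := Iso2 (comp_isoK j i) (comp_isoVK j i).

Lemma hcomp_isoK (X Y Z : B) (g g' : hom Y Z) (f f' : hom X Y)
  (j : iso2 g g') (i : iso2 f f') : (j^-1 ⋆ i^-1) • (j ⋆ i) = id2 (g ⋅ f).
Proof. by rewrite -hcomp_v !iso_fwdK hcomp_id. Qed.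

Lemma hcomp_isoVK (X Y Z : B) (g g' : hom Y Z) (f f' : hom X Y)
  (j : iso2 g g') (i : iso2 f f') : (j ⋆ i) • (j^-1 ⋆ i^-1) = id2 (g' ⋅ f').
Proof. by rewrite -hcomp_v !iso_invK hcomp_id. Qed.

Definition iso_hcomp (X Y Z : B) (g g' : hom Y Z) (f f' : hom X Y)
  (j : iso2 g g') (i : iso2 f f') : iso2 (g ⋅ f) (g' ⋅ f') :=
  Iso2 (hcomp_isoK j i) (hcomp_isoVK j i).

Fixpoint can X Y (e : wexpr X Y) Z : forall k : hom Z X, iso2 (ev e ⋅ k) (act e k) :=
  match e in wexpr X Y return forall k : hom Z X, iso2 (ev e ⋅ k) (act e k) with
  | wat f => fun k => iso_id (f ⋅ k)
  | wid _ => fun k => lunit k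
  | wcomp g f => fun k =>
      iso_comp (can g (act f k))
        (iso_comp (iso_hcomp (iso_id (ev g)) (can f k)) (assoc (ev g) (ev f) k))
  end.

Lemma can_nat X Y (e : wexpr X Y) Z (k k' : hom Z X) (c : cell k k') :
  can e k' • (id2 (ev e) ⋆ c) = actm e c • can e k.
Proof.
elim: e Z k k' c => [{}X {}Y f|{}X|{}X {}Y T g IHg f IHf] Z k k' c /=.
- by rewrite vcomp1l vcomp1r.
- by rewrite lunit_nat.
- rewrite -!vcompA -hcomp_id assoc_nat (vcompA (id2 (ev g) ⋆ can f k')) -whl_v.
  by rewrite IHf whl_v !vcompA IHg.
Qed.

Lemma act2_sig X Y (e e' : wexpr X Y) (a : cell (ev e) (ev e')) Z (k : hom Z X) :
  {c : cell (act e k) (act e' k) | c • can e k = can e' k • (a ⋆ id2 k)}.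
Proof.
exists (can e' k • (a ⋆ id2 k) • (can e k)^-1).
by rewrite -!vcompA iso_fwdK vcomp1r.
Qed.

Definition act2 X Y (e e' : wexpr X Y) (a : cell (ev e) (ev e')) Z (k : hom Z X) :
  cell (act e k) (act e' k) := proj1_sig (act2_sig a k).

Lemma act2_can X Y (e e' : wexpr X Y) (a : cell (ev e) (ev e')) Z (k : hom Z X) :
  act2 a k • can e k = can e' k • (a ⋆ id2 k).
Proof. exact: proj2_sig (act2_sig a k). Qed.

Inductive cexpr : forall X Y, wexpr X Y -> wexpr X Y -> Type :=
| c_at : forall X Y (e e' : wexpr X Y), cell (ev e) (ev e') -> cexpr e e'
| c_id : forall X Y (e : wexpr X Y), cexpr e e
| c_v : forall X Y (e e' e'' : wexpr X Y), cexpr e' e'' -> cexpr e e' -> cexpr e e''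
| c_h : forall X Y Z (g g' : wexpr Y Z) (f f' : wexpr X Y),
    cexpr g g' -> cexpr f f' -> cexpr (wcomp g f) (wcomp g' f')
| c_assoc : forall X Y Z T (h : wexpr Z T) (g : wexpr Y Z) (f : wexpr X Y),
    cexpr (wcomp (wcomp h g) f) (wcomp h (wcomp g f))
| c_associ : forall X Y Z T (h : wexpr Z T) (g : wexpr Y Z) (f : wexpr X Y),
    cexpr (wcomp h (wcomp g f)) (wcomp (wcomp h g) f)
| c_lunit : forall X Y (f : wexpr X Y), cexpr (wcomp (wid Y) f) f
| c_luniti : forall X Y (f : wexpr X Y), cexpr f (wcomp (wid Y) f)
| c_runit : forall X Y (f : wexpr X Y), cexpr (wcomp f (wid X)) f
| c_runiti : forall X Y (f : wexpr X Y), cexpr f (wcomp f (wid X)).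

Fixpoint cev X Y (e e' : wexpr X Y) (c : cexpr e e') : cell (ev e) (ev e') :=
  match c in @cexpr X Y e e' return cell (ev e) (ev e') with
  | c_at a => a
  | c_id e => id2 (ev e)
  | c_v b a => cev b • cev a
  | c_h b a => cev b ⋆ cev a
  | c_assoc h g f => assoc (ev h) (ev g) (ev f)
  | c_associ h g f => (assoc (ev h) (ev g) (ev f))^-1
  | c_lunit f => lunit (ev f)
  | c_luniti f => (lunit (ev f))^-1
  | c_runit f => runit (ev f)
  | c_runiti f => (runit (ev f))^-1
  end.

Fixpoint nact X Y (e e' : wexpr X Y) (c : cexpr e e') Z :
  forall k : hom Z X, cell (act e k) (act e' k) :=
  match c in @cexpr X Y e e' return
    forall k : hom Z X, cell (act e k) (act e' k) with
  | c_at a => fun k => act2 a k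
  | c_id e => fun k => id2 _
  | c_v b a => fun k => nact b k • nact a k
  | @c_h _ _ _ g g' f f' b a => fun k => nact b (act f' k) • actm g (nact a k)
  | c_assoc h g f => fun k => id2 _
  | c_associ h g f => fun k => id2 _
  | c_lunit f => fun k => id2 _
  | c_luniti f => fun k => id2 _
  | c_runit f => fun k => id2 _
  | c_runiti f => fun k => id2 _
  end.

Lemma act2_uniq X Y (e e' : wexpr X Y) (a : cell (ev e) (ev e')) Z (k : hom Z X)
  (c : cell (act e k) (act e' k)) :
  c • can e k = can e' k • (a ⋆ id2 k) -> act2 a k = c.
Proof. by move=> E; apply: (@iso_epi _ _ _ _ _ (can e k)); rewrite act2_can. Qed.

Lemma act2_v X Y (e e' e'' : wexpr X Y) (b : cell (ev e') (ev e''))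
  (a : cell (ev e) (ev e')) Z (k : hom Z X) :
  @act2 _ _ e e'' (b • a) _ k = act2 b k • act2 a k.
Proof. by apply: act2_uniq; rewrite whr_v -vcompA act2_can !vcompA act2_can. Qed.

Lemma act2_id X Y (e : wexpr X Y) Z (k : hom Z X) :
  @act2 _ _ e e (id2 _) _ k = id2 _.
Proof. by apply: act2_uniq; rewrite hcomp_id vcomp1l vcomp1r. Qed.

Lemma act2_nat X Y (e e' : wexpr X Y) (a : cell (ev e) (ev e'))
  Z (k k' : hom Z X) (c : cell k k') :
  act2 a k' • actm e c = actm e' c • act2 a k.
Proof.
apply: (@iso_epi _ _ _ _ _ (can e k)).
rewrite -!vcompA -can_nat act2_can !vcompA act2_can -can_nat -!vcompA.
by rewrite -!hcomp_v !vcomp1l !vcomp1r.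
Qed.

Lemma act2_assoc X Y Z T (h : wexpr Z T) (g : wexpr Y Z) (f : wexpr X Y)
   U (k : hom U X) :
  @act2 _ _ (wcomp (wcomp h g) f) (wcomp h (wcomp g f))
    (assoc (ev h) (ev g) (ev f)) _ k = id2 _.
Proof.
apply: act2_uniq; rewrite vcomp1l /=.
rewrite !whl_v -!vcompA; f_equal; f_equal.
by rewrite -pentagon -hcomp_id !vcompA assoc_nat.
Qed.

Lemma act2_lunit X Y (f : wexpr X Y) U (k : hom U X) :
  @act2 _ _ (wcomp (wid Y) f) f (lunit (ev f)) _ k = id2 _.
Proof. by apply: act2_uniq; rewrite vcomp1l /= vcompA lunit_nat -vcompA lunit_assoc. Qed.

Lemma act2_runit X Y (f : wexpr X Y) U (k : hom U X) :
  @act2 _ _ (wcomp f (wid X)) f (runit (ev f)) _ k = id2 _.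
Proof. by apply: act2_uniq; rewrite vcomp1l /= triangle. Qed.

Lemma act2_h X Y Z (g g' : wexpr Y Z) (f f' : wexpr X Y)
  (b : cell (ev g) (ev g')) (a : cell (ev f) (ev f')) T (k : hom T X) :
  @act2 _ _ (wcomp g f) (wcomp g' f') (b ⋆ a) _ k
  = act2 b (act f' k) • actm g (act2 a k).
Proof.
apply: act2_uniq => /=.
rewrite -!vcompA (vcompA (actm g _)) -can_nat -!vcompA.
rewrite (vcompA (id2 _ ⋆ act2 a k)) -whl_v act2_can whl_v.
rewrite (vcompA (act2 b _)) act2_can -!vcompA assoc_nat; f_equal.
rewrite !vcompA; f_equal; rewrite -!hcomp_v.
by rewrite !vcomp1l !vcomp1r.
Qed.

Lemma nactE X Y (e e' : wexpr X Y) (c : cexpr e e') Z (k : hom Z X) :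
  act2 (cev c) k = nact c k.
Proof.
elim: c Z k => {X Y e e'}.
- by [].
- by move=> X Y e Z k; rewrite /= act2_id.
- by move=> X Y e e' e'' b IHb a IHa Z k; rewrite /= act2_v IHb IHa.
- by move=> X Y Z g g' f f' b IHb a IHa T k; rewrite /= act2_h IHb IHa.
- by move=> X Y Z T h g f U k; rewrite /= act2_assoc.
- move=> X Y Z T h g f U k.
  have := @act2_v _ _ (wcomp (wcomp h g) f) (wcomp h (wcomp g f))
    (wcomp (wcomp h g) f)
    (assoc (ev h) (ev g) (ev f))^-1 (assoc (ev h) (ev g) (ev f)) _ k.
  by rewrite iso_fwdK act2_id act2_assoc vcomp1r => <-.
- by move=> X Y f U k; rewrite /= act2_lunit.
- move=> X Y f U k.
  have := @act2_v _ _ (wcomp (wid Y) f) f (wcomp (wid Y) f)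
    (lunit (ev f))^-1 (lunit (ev f)) _ k.
  by rewrite iso_fwdK act2_id act2_lunit vcomp1r => <-.
- by move=> X Y f U k; rewrite /= act2_runit.
- move=> X Y f U k.
  have := @act2_v _ _ (wcomp f (wid X)) f (wcomp f (wid X))
    (runit (ev f))^-1 (runit (ev f)) _ k.
  by rewrite iso_fwdK act2_id act2_runit vcomp1r => <-.
Qed.

Lemma act2_inj X Y (e e' : wexpr X Y) (a b : cell (ev e) (ev e')) :
  act2 a (id1 X) = act2 b (id1 X) -> a = b.
Proof.
move=> E; apply: wh1r_inj.
apply: (@iso_mono _ _ _ _ _ (can e' (id1 X))).
by rewrite -!act2_can E.
Qed.

Lemma coh_bwd X Y (e e' : wexpr X Y) (c c' : cexpr e e') :
  (forall Z (k : hom Z X), nact c k = nact c' k) -> cev c = cev c'.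
Proof. by move=> E; apply: act2_inj; rewrite !nactE E. Qed.

Lemma coh_fwd X Y (e e' : wexpr X Y) (c c' : cexpr e e') :
  cev c = cev c' -> forall Z (k : hom Z X), nact c k = nact c' k.
Proof. by move=> E Z k; rewrite -!nactE E. Qed.

Lemma act2K X Y (e e' : wexpr X Y) (i : iso2 (ev e) (ev e')) Z (k : hom Z X) :
  act2 i^-1 k • act2 i k = id2 _.
Proof. by rewrite -act2_v iso_fwdK act2_id. Qed.

Lemma act2VK X Y (e e' : wexpr X Y) (i : iso2 (ev e) (ev e')) Z (k : hom Z X) :
  act2 i k • act2 i^-1 k = id2 _.
Proof. by rewrite -act2_v iso_invK act2_id. Qed.

Lemma eq_v (X Y : B) (f g h k : hom X Y) (b : cell g h) (a : cell f g) (d : cell f h) :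
  b • a = d -> forall z : cell k f, b • (a • z) = d • z.
Proof. by move=> <- z; rewrite vcompA. Qed.

Lemma eq_v3 (X Y : B) (f g h l k : hom X Y) (c : cell h l) (b : cell g h)
  (a : cell f g) (d : cell f l) :
  c • (b • a) = d -> forall z : cell k f, c • (b • (a • z)) = d • z.
Proof. by move=> <- z; rewrite !vcompA. Qed.

End Coherence.

Arguments wat {B X Y} _.
Arguments wid {B} X.
Arguments c_at {B X Y} e e' _.
Arguments act2 {B X Y} e e' a {Z} k.

Ltac reify1 B f :=
  lazymatch f with
  | @comp1 _ _ _ _ ?g ?h =>
      let a := reify1 B g in let b := reify1 B h in
      constr:(@wcomp B _ _ _ a b)
  | @id1 _ ?X => constr:(@wid B X)
  | _ => constr:(@wat B _ _ f)
  end.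

Ltac reify2 B t e e' :=
  lazymatch t with
  | @vcomp _ _ _ _ ?g _ ?b ?a =>
      let m := reify1 B g in
      let cb := reify2 B b m e' in let ca := reify2 B a e m in
      constr:(@c_v B _ _ e m e' cb ca)
  | @id2 _ _ _ _ => constr:(@c_id B _ _ e)
  | @hcomp _ _ _ _ ?g ?g' ?f ?f' ?b ?a =>
      let eg := reify1 B g in let eg' := reify1 B g' in
      let ef := reify1 B f in let ef' := reify1 B f' in
      let cb := reify2 B b eg eg' in let ca := reify2 B a ef ef' in
      constr:(@c_h B _ _ _ eg eg' ef ef' cb ca)
  | iso_fwd (assoc ?h ?g ?f) =>
      let eh := reify1 B h in let eg := reify1 B g in let ef := reify1 B f in
      constr:(@c_assoc B _ _ _ _ eh eg ef)
  | iso_inv (assoc ?h ?g ?f) =>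
      let eh := reify1 B h in let eg := reify1 B g in let ef := reify1 B f in
      constr:(@c_associ B _ _ _ _ eh eg ef)
  | iso_fwd (lunit ?f) => let ef := reify1 B f in constr:(@c_lunit B _ _ ef)
  | iso_inv (lunit ?f) => let ef := reify1 B f in constr:(@c_luniti B _ _ ef)
  | iso_fwd (runit ?f) => let ef := reify1 B f in constr:(@c_runit B _ _ ef)
  | iso_inv (runit ?f) => let ef := reify1 B f in constr:(@c_runiti B _ _ ef)
  | _ => constr:(@c_at B _ _ e e' t)
  end.

Ltac coh_simp :=
  cbn [nact actm act ev];
  rewrite ?(hcomp_id, vcomp1l, vcomp1r, whl_v) -?vcompA.

(* Reduce an equality of 2-cells to one between their strictified actions. *)
Ltac coh :=
  lazymatch goal with
  | |- @eq (@cell (bdata ?B) ?X ?Y ?f ?g) ?L ?R =>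
      let e := reify1 B f in let e' := reify1 B g in
      let l := reify2 B L e e' in let r := reify2 B R e e' in
      change (cev l = cev r);
      let Z := fresh "Z" in let k := fresh "k" in
      apply coh_bwd; intros Z k; coh_simp
  end.

(* The strictified form of an equation [H], acting on [k]. *)
Ltac coh_have E H k :=
  let T := type of H in
  lazymatch T with
  | @eq (@cell (bdata ?B) ?X ?Y ?f ?g) ?L ?R =>
      let e := reify1 B f in let e' := reify1 B g in
      let l := reify2 B L e e' in let r := reify2 B R e e' in
      pose proof (@coh_fwd B X Y e e' l r H _ k) as E;
      cbn [nact actm act ev] in E;
      rewrite ?(hcomp_id, vcomp1l, vcomp1r, whl_v) -?vcompA in E
  end.

(* Interchange of the actions of [a] and of [c], the latter acting on [k]. *)
Ltac coh_nat E a c k :=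
  let act_of c tac :=
    lazymatch type of c with
    | @iso2 (bdata ?B) _ _ ?f ?g =>
        let e := reify1 B f in let e' := reify1 B g in
        tac B e e' (iso_fwd c)
    | @cell (bdata ?B) _ _ ?f ?g =>
        let e := reify1 B f in let e' := reify1 B g in tac B e e' c
    end in
  act_of a ltac:(fun B ea ea' a0 => act_of c ltac:(fun B ec ec' c0 =>
    pose proof (@act2_nat B _ _ ea ea' a0 _ _ _ (@act2 B _ _ ec ec' c0 _ k)) as E;
    cbn [nact actm act ev] in E;
    rewrite ?(hcomp_id, vcomp1l, vcomp1r, whl_v) -?vcompA in E)).

Record psfun (C D : bicat) := Psfun {
  F0 :> C -> D;
  F1 : forall X Y : C, hom X Y -> hom (F0 X) (F0 Y);
  F2 : forall (X Y : C) (f g : hom X Y), cell f g -> cell (F1 f) (F1 g);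
  phi : forall (X Y Z : C) (g : hom Y Z) (f : hom X Y),
    iso2 (F1 g ⋅ F1 f) (F1 (g ⋅ f));
  xi : forall X : C, iso2 (id1 (F0 X)) (F1 (id1 X));
  F2_id : forall (X Y : C) (f : hom X Y), F2 (id2 f) = id2 (F1 f);
  F2_v : forall (X Y : C) (f g h : hom X Y) (b : cell g h) (a : cell f g),
    F2 (b • a) = F2 b • F2 a;
  phi_nat : forall (X Y Z : C) (g g' : hom Y Z) (f f' : hom X Y)
    (b : cell g g') (a : cell f f'),
    phi g' f' • (F2 b ⋆ F2 a) = F2 (b ⋆ a) • phi g f;
  phi_assoc : forall (X Y Z T : C) (h : hom Z T) (g : hom Y Z) (f : hom X Y),
    F2 (assoc h g f) • phi (h ⋅ g) f • (phi h g ⋆ id2 (F1 f))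
    = phi h (g ⋅ f) • (id2 (F1 h) ⋆ phi g f) • assoc (F1 h) (F1 g) (F1 f);
  phi_lunit : forall (X Y : C) (f : hom X Y),
    F2 (lunit f) • phi (id1 Y) f • (xi Y ⋆ id2 (F1 f)) = lunit (F1 f);
  phi_runit : forall (X Y : C) (f : hom X Y),
    F2 (runit f) • phi f (id1 X) • (id2 (F1 f) ⋆ xi X) = runit (F1 f) }.

Arguments F1 {C D} p {X Y} f : rename.
Arguments F2 {C D} p {X Y f g} a : rename.
Arguments phi {C D} p {X Y Z} g f : rename.
Arguments xi {C D} p X : rename.

Section PsfunComp.

Lemma F2_isoK (C D : bicat) (F : psfun C D) (X Y : C) (f g : hom X Y)
  (i : iso2 f g) : F2 F i^-1 • F2 F i = id2 (F1 F f).
Proof. by rewrite -F2_v iso_fwdK F2_id. Qed.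

Lemma F2_isoVK (C D : bicat) (F : psfun C D) (X Y : C) (f g : hom X Y)
  (i : iso2 f g) : F2 F i • F2 F i^-1 = id2 (F1 F g).
Proof. by rewrite -F2_v iso_invK F2_id. Qed.

Definition F2_iso (C D : bicat) (F : psfun C D) (X Y : C) (f g : hom X Y)
  (i : iso2 f g) : iso2 (F1 F f) (F1 F g) := Iso2 (F2_isoK F i) (F2_isoVK F i).

Lemma phi_whl (C D : bicat) (F : psfun C D) (X Y Z : C) (g : hom Y Z)
  (f f' : hom X Y) (a : cell f f') :
  phi F g f' • (id2 (F1 F g) ⋆ F2 F a) = F2 F (id2 g ⋆ a) • phi F g f.
Proof. by rewrite -phi_nat F2_id. Qed.

Lemma phi_whr (C D : bicat) (F : psfun C D) (X Y Z : C) (g g' : hom Y Z)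
  (f : hom X Y) (b : cell g g') :
  phi F g' f • (F2 F b ⋆ id2 (F1 F f)) = F2 F (b ⋆ id2 f) • phi F g f.
Proof. by rewrite -phi_nat F2_id. Qed.

Definition psfun_id (C : bicat) : psfun C C.
Proof.
refine (@Psfun C C (fun X => X) (fun _ _ f => f) (fun _ _ _ _ a => a)
  (fun _ _ _ g f => iso_id (g ⋅ f)) (fun X => iso_id (id1 X)) _ _ _ _ _ _);
  intros; cbn; by rewrite ?hcomp_id ?vcomp1l ?vcomp1r.
Defined.

Variables (B C D : bicat) (G : psfun C D) (F : psfun B C).

Definition psfun_comp : psfun B D.
Proof.
refine (@Psfun B D (fun X => G (F X)) (fun _ _ f => F1 G (F1 F f))
  (fun _ _ _ _ a => F2 G (F2 F a))
  (fun _ _ _ g f => iso_comp (F2_iso G (phi F g f)) (phi G (F1 F g) (F1 F f)))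
  (fun X => iso_comp (F2_iso G (xi F X)) (xi G (F X))) _ _ _ _ _ _);
  intros; cbn.
- by rewrite !F2_id.
- by rewrite !F2_v.
- by rewrite -vcompA phi_nat !vcompA -!F2_v phi_nat.
- have E := f_equal (F2 G) (phi_assoc F h g f); rewrite !F2_v in E.
  rewrite whr_v whl_v -!vcompA (eq_v (phi_whr _ _ _)) -!vcompA (eq_v3 E).
  by rewrite -!vcompA phi_assoc (eq_v (phi_whl _ _ _)) -!vcompA.
- have E := f_equal (F2 G) (phi_lunit F f); rewrite !F2_v in E.
  by rewrite whr_v -!vcompA (eq_v (phi_whr _ _ _)) -!vcompA (eq_v3 E) phi_lunit.
- have E := f_equal (F2 G) (phi_runit F f); rewrite !F2_v in E.
  by rewrite whl_v -!vcompA (eq_v (phi_whl _ _ _)) -!vcompA (eq_v3 E) phi_runit.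
Defined.

End PsfunComp.

Record pnat (C D : bicat) (F G : psfun C D) := Pnat {
  t0 :> forall X : C, hom (F X) (G X);
  t1 : forall (X Y : C) (f : hom X Y), iso2 (F1 G f ⋅ t0 X) (t0 Y ⋅ F1 F f);
  t1_nat : forall (X Y : C) (f g : hom X Y) (a : cell f g),
    t1 g • (F2 G a ⋆ id2 (t0 X)) = (id2 (t0 Y) ⋆ F2 F a) • t1 f;
  t1_id : forall X : C,
    t1 (id1 X) • (xi G X ⋆ id2 (t0 X))
    = (id2 (t0 X) ⋆ xi F X) • (runit (t0 X))^-1 • lunit (t0 X);
  t1_comp : forall (X Y Z : C) (g : hom Y Z) (f : hom X Y),
    t1 (g ⋅ f) • (phi G g f ⋆ id2 (t0 X))
    = (id2 (t0 Z) ⋆ phi F g f) • assoc (t0 Z) (F1 F g) (F1 F f)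
      • (t1 g ⋆ id2 (F1 F f)) • (assoc (F1 G g) (t0 Y) (F1 F f))^-1
      • (id2 (F1 G g) ⋆ t1 f) • assoc (F1 G g) (F1 G f) (t0 X) }.

Arguments t0 {C D F G} p X : rename.
Arguments t1 {C D F G} p {X Y} f : rename.

Record modif (C D : bicat) (F G : psfun C D) (s t : pnat F G) := Modif {
  m0 :> forall X : C, cell (s X) (t X);
  m0_nat : forall (X Y : C) (f : hom X Y),
    t1 t f • (id2 (F1 G f) ⋆ m0 X) = (m0 Y ⋆ id2 (F1 F f)) • t1 s f }.

Lemma modif_eq (C D : bicat) (F G : psfun C D) (s t : pnat F G)
  (m n : modif s t) : (forall X, m X = n X) -> m = n.
Proof.
case: m n => [m Hm] [n Hn] /= E.
have {}E : m = n by apply: functional_extensionality_dep.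
by subst n; rewrite (proof_irrelevance _ Hm Hn).
Qed.

Section HomBicat.
Variables C D : bicat.

Definition pnat_id (F : psfun C D) : pnat F F.
Proof.
refine (@Pnat C D F F (fun X => id1 (F X))
  (fun X Y f => iso_comp (iso_sym (lunit (F1 F f))) (runit (F1 F f))) _ _ _);
  intros; cbn; coh => //.
Defined.

Section PnatComp.
Variables (F G H : psfun C D) (t : pnat G H) (s : pnat F G).

Definition pnat_comp1 (X Y : C) (f : hom X Y) :
  iso2 (F1 H f ⋅ (t X ⋅ s X)) ((t Y ⋅ s Y) ⋅ F1 F f) :=
  iso_comp (iso_sym (assoc (t Y) (s Y) (F1 F f)))
 (iso_comp (iso_hcomp (iso_id (t Y)) (t1 s f))
 (iso_comp (assoc (t Y) (F1 G f) (s X))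
 (iso_comp (iso_hcomp (t1 t f) (iso_id (s X)))
   (iso_sym (assoc (F1 H f) (t X) (s X)))))).

Lemma pnat_comp_nat (X Y : C) (f g : hom X Y) (a : cell f g) :
  pnat_comp1 g • (F2 H a ⋆ id2 (t X ⋅ s X))
  = (id2 (t Y ⋅ s Y) ⋆ F2 F a) • pnat_comp1 f.
Proof.
cbn; coh.
coh_have E1 (t1_nat t a) (s X ⋅ k); rewrite E1.
coh_have E2 (t1_nat s a) k.
by rewrite !vcompA -!whl_v E2.
Qed.

Lemma pnat_comp_id (X : C) :
  pnat_comp1 (id1 X) • (xi H X ⋆ id2 (t X ⋅ s X))
  = (id2 (t X ⋅ s X) ⋆ xi F X) • (runit (t X ⋅ s X))^-1 • lunit (t X ⋅ s X).
Proof.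
cbn; coh.
coh_have E1 (t1_id t X) (s X ⋅ k); rewrite E1.
coh_have E2 (t1_id s X) k.
by rewrite -!whl_v E2.
Qed.

Lemma pnat_comp_comp (X Y Z : C) (g : hom Y Z) (f : hom X Y) :
  pnat_comp1 (g ⋅ f) • (phi H g f ⋆ id2 (t X ⋅ s X))
  = (id2 (t Z ⋅ s Z) ⋆ phi F g f) • assoc (t Z ⋅ s Z) (F1 F g) (F1 F f)
    • (pnat_comp1 g ⋆ id2 (F1 F f)) • (assoc (F1 H g) (t Y ⋅ s Y) (F1 F f))^-1
    • (id2 (F1 H g) ⋆ pnat_comp1 f) • assoc (F1 H g) (F1 H f) (t X ⋅ s X).
Proof.
cbn; coh.
coh_have E1 (t1_comp t g f) (s X ⋅ k); rewrite E1.
coh_have E2 (t1_comp s g f) k.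
coh_nat E3 (t1 t g) (t1 s f) k.
by rewrite vcompA -whl_v E2 !whl_v -!vcompA (eq_v E3) -!vcompA.
Qed.

Definition pnat_comp : pnat F H :=
  @Pnat C D F H (fun X => t X ⋅ s X) pnat_comp1 pnat_comp_nat pnat_comp_id
    pnat_comp_comp.

End PnatComp.

Section Modif.
Variables F G : psfun C D.

Lemma modif_id_nat (s : pnat F G) (X Y : C) (f : hom X Y) :
  t1 s f • (id2 (F1 G f) ⋆ id2 (s X)) = (id2 (s Y) ⋆ id2 (F1 F f)) • t1 s f.
Proof. by rewrite !hcomp_id vcomp1l vcomp1r. Qed.

Definition modif_id (s : pnat F G) : modif s s :=
  @Modif C D F G s s (fun X => id2 (s X)) (@modif_id_nat s).

Lemma modif_v_nat (s t u : pnat F G) (n : modif t u) (m : modif s t)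
  (X Y : C) (f : hom X Y) :
  t1 u f • (id2 (F1 G f) ⋆ (n X • m X)) = ((n Y • m Y) ⋆ id2 (F1 F f)) • t1 s f.
Proof. by rewrite whl_v whr_v vcompA m0_nat -vcompA m0_nat vcompA. Qed.

Definition modif_v (s t u : pnat F G) (n : modif t u) (m : modif s t) : modif s u :=
  @Modif C D F G s u (fun X => n X • m X) (modif_v_nat n m).

End Modif.

Lemma modif_h_nat (F G H : psfun C D) (t t' : pnat G H) (s s' : pnat F G)
  (n : modif t t') (m : modif s s') (X Y : C) (f : hom X Y) :
  pnat_comp1 t' s' f • (id2 (F1 H f) ⋆ (n X ⋆ m X))
  = ((n Y ⋆ m Y) ⋆ id2 (F1 F f)) • pnat_comp1 t s f.
Proof.
cbn; coh.
coh_have E1 (m0_nat n f) (s' X ⋅ k).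
coh_have E2 (m0_nat m f) k.
coh_nat E3 (t1 t f) (m X) k.
coh_nat E4 (n Y) (t1 s' f) k.
rewrite (eq_v E1) -vcompA E3 [LHS]vcompA -E4 -!vcompA; f_equal.
by rewrite vcompA -whl_v E2 whl_v -!vcompA.
Qed.

Definition modif_h (F G H : psfun C D) (t t' : pnat G H) (s s' : pnat F G)
  (n : modif t t') (m : modif s s') : modif (pnat_comp t s) (pnat_comp t' s') :=
  @Modif C D F H (pnat_comp t s) (pnat_comp t' s') (fun X => n X ⋆ m X)
    (modif_h_nat n m).

Definition hom_data : bicat_data :=
  @BicatData (psfun C D) (@pnat C D) (fun F G => @modif C D F G)
    pnat_id (fun F G H t s => pnat_comp t s)
    (fun F G => @modif_id F G) (fun F G => @modif_v F G)
    (fun F G H t t' s s' => @modif_h F G H t t' s s').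

Section ModifIso.
Variables (F G : psfun C D) (s t : pnat F G) (i : forall X, iso2 (s X) (t X)).
Hypothesis Hi : forall (X Y : C) (f : hom X Y),
  t1 t f • (id2 (F1 G f) ⋆ i X) = (i Y ⋆ id2 (F1 F f)) • t1 s f.

Lemma modif_inv_nat (X Y : C) (f : hom X Y) :
  t1 s f • (id2 (F1 G f) ⋆ (i X)^-1) = ((i Y)^-1 ⋆ id2 (F1 F f)) • t1 t f.
Proof.
apply: (@iso_mono _ _ _ _ _ _ (iso_hcomp (i Y) (iso_id (F1 F f)))).
rewrite /= !vcompA -Hi -hcomp_v iso_invK vcomp1l hcomp_id vcomp1l.
by rewrite -vcompA -hcomp_v iso_invK vcomp1l hcomp_id vcomp1r.
Qed.

Definition modif_fwd : modif s t := @Modif C D F G s t (fun X => i X) Hi.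
Definition modif_bwd : modif t s :=
  @Modif C D F G t s (fun X => (i X)^-1) modif_inv_nat.

Lemma modif_fwdK : modif_v modif_bwd modif_fwd = modif_id s.
Proof. by apply: modif_eq => X; apply: iso_fwdK. Qed.

Lemma modif_invK : modif_v modif_fwd modif_bwd = modif_id t.
Proof. by apply: modif_eq => X; apply: iso_invK. Qed.

Definition modif_iso : @iso2 hom_data F G s t :=
  @Iso2 hom_data F G s t modif_fwd modif_bwd modif_fwdK modif_invK.

End ModifIso.

Lemma hom_assoc_nat (E F G H : psfun C D) (u : pnat G H) (t : pnat F G)
  (s : pnat E F) (X Y : C) (f : hom X Y) :
  pnat_comp1 u (pnat_comp t s) f • (id2 (F1 H f) ⋆ assoc (u X) (t X) (s X))
  = (assoc (u Y) (t Y) (s Y) ⋆ id2 (F1 E f)) • pnat_comp1 (pnat_comp u t) s f.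
Proof. by cbn; coh. Qed.

Lemma hom_lunit_nat (F G : psfun C D) (s : pnat F G) (X Y : C) (f : hom X Y) :
  t1 s f • (id2 (F1 G f) ⋆ lunit (s X))
  = (lunit (s Y) ⋆ id2 (F1 F f)) • pnat_comp1 (pnat_id G) s f.
Proof. by cbn; coh. Qed.

Lemma hom_runit_nat (F G : psfun C D) (s : pnat F G) (X Y : C) (f : hom X Y) :
  t1 s f • (id2 (F1 G f) ⋆ runit (s X))
  = (runit (s Y) ⋆ id2 (F1 F f)) • pnat_comp1 s (pnat_id F) f.
Proof. by cbn; coh. Qed.

Definition Hom : bicat.
Proof.
refine (@Bicat hom_data
  (fun E F G H u t s => @modif_iso E H (pnat_comp (pnat_comp u t) s)
    (pnat_comp u (pnat_comp t s)) (fun X => assoc (u X) (t X) (s X))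
    (hom_assoc_nat u t s))
  (fun F G s => @modif_iso F G (pnat_comp (pnat_id G) s) s
    (fun X => lunit (s X)) (hom_lunit_nat s))
  (fun F G s => @modif_iso F G (pnat_comp s (pnat_id F)) s
    (fun X => runit (s X)) (hom_runit_nat s))
  _ _ _ _ _ _ _ _ _ _); intros; apply modif_eq; intro A.
- abstract exact: vcompA.
- abstract exact: vcomp1l.
- abstract exact: vcomp1r.
- abstract exact: hcomp_id.
- abstract exact: hcomp_v.
- abstract exact: assoc_nat.
- abstract exact: lunit_nat.
- abstract exact: runit_nat.
- abstract exact: pentagon.
- abstract exact: triangle.
Defined.

End HomBicat.

Section Precomp.
Variables (A B D : bicat) (F : psfun A B).

Section PnatWhisker.
Variables (G G' : psfun B D) (t : pnat G G').

Lemma pnat_wh_id (X : A) :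
  t1 t (F1 F (id1 X)) • (xi (psfun_comp G' F) X ⋆ id2 (t (F X)))
  = (id2 (t (F X)) ⋆ xi (psfun_comp G F) X)
    • (runit (t (F X)))^-1 • lunit (t (F X)).
Proof.
cbn; rewrite whr_v whl_v vcompA t1_nat -!vcompA; f_equal.
exact: t1_id.
Qed.

Lemma pnat_wh_comp (X Y Z : A) (g : hom Y Z) (f : hom X Y) :
  t1 t (F1 F (g ⋅ f)) • (phi (psfun_comp G' F) g f ⋆ id2 (t (F X)))
  = (id2 (t (F Z)) ⋆ phi (psfun_comp G F) g f)
    • assoc (t (F Z)) (F1 G (F1 F g)) (F1 G (F1 F f))
    • (t1 t (F1 F g) ⋆ id2 (F1 G (F1 F f)))
    • (assoc (F1 G' (F1 F g)) (t (F Y)) (F1 G (F1 F f)))^-1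
    • (id2 (F1 G' (F1 F g)) ⋆ t1 t (F1 F f))
    • assoc (F1 G' (F1 F g)) (F1 G' (F1 F f)) (t (F X)).
Proof.
cbn; rewrite whr_v whl_v vcompA t1_nat -!vcompA; f_equal.
exact: t1_comp.
Qed.

Definition pnat_wh : pnat (psfun_comp G F) (psfun_comp G' F) :=
  @Pnat A D (psfun_comp G F) (psfun_comp G' F) (fun X => t (F X))
    (fun X Y f => t1 t (F1 F f)) (fun X Y f g a => t1_nat t (F2 F a))
    pnat_wh_id pnat_wh_comp.

End PnatWhisker.

Definition modif_wh (G G' : psfun B D) (s t : pnat G G') (m : modif s t) :
  modif (pnat_wh s) (pnat_wh t) :=
  @Modif A D (psfun_comp G F) (psfun_comp G' F) (pnat_wh s) (pnat_wh t)
    (fun X => m (F X)) (fun X Y f => m0_nat m (F1 F f)).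

Lemma precomp_phi_nat (G G' G'' : psfun B D) (t : pnat G' G'') (s : pnat G G')
  (X Y : A) (f : hom X Y) :
  t1 (pnat_wh (pnat_comp t s)) f
    • (id2 (F1 (psfun_comp G'' F) f) ⋆ id2 (t (F X) ⋅ s (F X)))
  = (id2 (t (F Y) ⋅ s (F Y)) ⋆ id2 (F1 (psfun_comp G F) f))
    • t1 (pnat_comp (pnat_wh t) (pnat_wh s)) f.
Proof. by rewrite !hcomp_id vcomp1r vcomp1l. Qed.

Lemma precomp_xi_nat (G : psfun B D) (X Y : A) (f : hom X Y) :
  t1 (pnat_wh (pnat_id G)) f
    • (id2 (F1 (psfun_comp G F) f) ⋆ id2 (id1 (G (F X))))
  = (id2 (id1 (G (F Y))) ⋆ id2 (F1 (psfun_comp G F) f))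
    • t1 (pnat_id (psfun_comp G F)) f.
Proof. by rewrite !hcomp_id vcomp1r vcomp1l. Qed.

Definition precomp : psfun (Hom B D) (Hom A D).
Proof.
refine (@Psfun (Hom B D) (Hom A D) (fun G => psfun_comp G F)
  (fun G G' t => pnat_wh t) (fun G G' s t m => modif_wh m)
  (fun G G' G'' t s =>
    @modif_iso A D (psfun_comp G F) (psfun_comp G'' F)
      (pnat_comp (pnat_wh t) (pnat_wh s)) (pnat_wh (pnat_comp t s))
      (fun X => iso_id (t (F X) ⋅ s (F X))) (precomp_phi_nat t s))
  (fun G =>
    @modif_iso A D (psfun_comp G F) (psfun_comp G F)
      (pnat_id (psfun_comp G F)) (pnat_wh (pnat_id G))
      (fun X => iso_id (id1 (G (F X)))) (precomp_xi_nat G))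
  _ _ _ _ _ _); intros; apply modif_eq; intro U; cbn.
- by [].
- by [].
- abstract by rewrite vcomp1l vcomp1r.
- abstract by rewrite !hcomp_id !vcomp1l !vcomp1r.
- abstract by rewrite !hcomp_id !vcomp1r.
- abstract by rewrite !hcomp_id !vcomp1r.
Defined.

End Precomp.

Section FullSub.
Variables (B : bicat) (P : B -> Prop).

Definition full_sub_data : bicat_data :=
  @BicatData {X : B | P X} (fun X Y => hom (proj1_sig X) (proj1_sig Y))
    (fun X Y f g => cell f g) (fun X => id1 (proj1_sig X))
    (fun X Y Z g f => g ⋅ f) (fun X Y f => id2 f) (fun X Y f g h b a => b • a)
    (fun X Y Z g g' f f' b a => b ⋆ a).

Definition full_sub_iso (X Y : full_sub_data) (f g : hom X Y)
  (i : @iso2 B (proj1_sig X) (proj1_sig Y) f g) : iso2 f g :=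
  @Iso2 full_sub_data X Y f g i i^-1 (iso_fwdK i) (iso_invK i).

Definition full_sub : bicat :=
  @Bicat full_sub_data
    (fun X Y Z T h g f => @full_sub_iso X T ((h ⋅ g) ⋅ f) (h ⋅ (g ⋅ f))
      (@assoc B _ _ _ _ h g f))
    (fun X Y f => @full_sub_iso X Y (id1 Y ⋅ f) f (@lunit B _ _ f))
    (fun X Y f => @full_sub_iso X Y (f ⋅ id1 X) f (@runit B _ _ f))
    (fun _ _ => @vcompA B _ _) (fun _ _ => @vcomp1l B _ _)
    (fun _ _ => @vcomp1r B _ _) (fun _ _ _ => @hcomp_id B _ _ _)
    (fun _ _ _ => @hcomp_v B _ _ _) (fun _ _ _ _ => @assoc_nat B _ _ _ _)
    (fun _ _ => @lunit_nat B _ _) (fun _ _ => @runit_nat B _ _)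
    (fun _ _ _ _ _ => @pentagon B _ _ _ _ _) (fun _ _ _ => @triangle B _ _ _).

End FullSub.

Definition psfun_restrict (B B' : bicat) (P : B -> Prop) (P' : B' -> Prop)
  (F : psfun B B') (HF : forall X, P X -> P' (F X)) :
  psfun (full_sub P) (full_sub P') :=
  @Psfun (full_sub P) (full_sub P')
    (fun X => exist P' (F (proj1_sig X)) (HF _ (proj2_sig X)))
    (fun X Y f => F1 F f) (fun X Y f g a => F2 F a)
    (fun X Y Z g f => full_sub_iso (X := exist P' _ _) (Y := exist P' _ _) (phi F g f))
    (fun X => full_sub_iso (X := exist P' _ _) (Y := exist P' _ _) (xi F (proj1_sig X)))
    (fun _ _ => @F2_id _ _ F _ _) (fun _ _ => @F2_v _ _ F _ _)
    (fun _ _ _ => @phi_nat _ _ F _ _ _)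
    (fun _ _ _ _ => @phi_assoc _ _ F _ _ _ _)
    (fun _ _ => @phi_lunit _ _ F _ _) (fun _ _ => @phi_runit _ _ F _ _).

Definition arrow_family (C : bicat) : Type := forall X Y : C, hom X Y -> Prop.

Definition contains_ids (C : bicat) (W : arrow_family C) : Prop :=
  forall X : C, W X X (id1 X).

Definition maps_into (C D : bicat) (F : psfun C D) (W : arrow_family C)
  (V : arrow_family D) : Prop :=
  forall (X Y : C) (f : hom X Y), W X Y f -> V (F X) (F Y) (F1 F f).

Inductive image_family (C D : bicat) (F : psfun C D) (W : arrow_family C) :
  arrow_family D :=
| image_intro : forall (X Y : C) (f : hom X Y), W X Y f ->
    image_family F W (F1 F f).

Definition equivalence (C : bicat) : arrow_family C := fun X Y f =>
  exists g : hom Y X,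
    inhabited (iso2 (g ⋅ f) (id1 X)) /\ inhabited (iso2 (f ⋅ g) (id1 Y)).

Definition quasiequivalence (C : bicat) : arrow_family C := fun X Y f =>
  forall Z : C,
    (forall a b : hom Z X,
      (forall c c' : cell a b, id2 f ⋆ c = id2 f ⋆ c' -> c = c')
      /\ (forall d : cell (f ⋅ a) (f ⋅ b), exists c : cell a b, id2 f ⋆ c = d))
    /\ (forall a b : hom Y Z,
      (forall c c' : cell a b, c ⋆ id2 f = c' ⋆ id2 f -> c = c')
      /\ (forall d : cell (a ⋅ f) (b ⋅ f), exists c : cell a b, c ⋆ id2 f = d)).

Inductive is_identity (C : bicat) (X Y : C) :
  forall f g : hom X Y, cell f g -> Prop :=
| is_identity_id2 : forall f : hom X Y, is_identity (id2 f).

Definition is_2functor (C D : bicat) (F : psfun C D) : Prop :=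
  (forall (X Y Z : C) (g : hom Y Z) (f : hom X Y), is_identity (phi F g f))
  /\ (forall X : C, is_identity (xi F X)).

Definition is_biequivalence (C D : bicat) (F : psfun C D) : Prop :=
  exists (G : psfun D C) (s : pnat (psfun_comp G F) (psfun_id C))
    (t : pnat (psfun_comp F G) (psfun_id D)),
    (forall X : C, equivalence (s X)) /\ (forall Y : D, equivalence (t Y)).

Definition is_isomorphism (C D : bicat) (F : psfun C D) : Prop :=
  exists G : psfun D C,
    psfun_comp G F = psfun_id C /\ psfun_comp F G = psfun_id D.

Definition Hom_equiv (C : bicat) (S : arrow_family C) (D : bicat) : bicat :=
  full_sub (B := Hom C D) (fun F => maps_into F S (@equivalence D)).

Section ImageCells.
Variables (C D : bicat) (F : psfun C D).

(* The horizontal composition that the 2-cells of [D] induce, through [phi],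
   between images of arrows of [C].  [hc] is kept opaque to rewriting; see
   [hc_def]. *)
Lemma hc_sig (X Y Z : C) (g g' : hom Y Z) (f f' : hom X Y)
  (b : cell (F1 F g) (F1 F g')) (a : cell (F1 F f) (F1 F f')) :
  {c : cell (F1 F (g ⋅ f)) (F1 F (g' ⋅ f')) |
    c = phi F g' f' • (b ⋆ a) • (phi F g f)^-1}.
Proof. by eexists. Qed.

Definition hc (X Y Z : C) (g g' : hom Y Z) (f f' : hom X Y)
  (b : cell (F1 F g) (F1 F g')) (a : cell (F1 F f) (F1 F f')) :
  cell (F1 F (g ⋅ f)) (F1 F (g' ⋅ f')) := proj1_sig (hc_sig b a).

Lemma hc_def (X Y Z : C) (g g' : hom Y Z) (f f' : hom X Y)
  (b : cell (F1 F g) (F1 F g')) (a : cell (F1 F f) (F1 F f')) :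
  hc b a = phi F g' f' • (b ⋆ a) • (phi F g f)^-1.
Proof. exact: proj2_sig (hc_sig b a). Qed.

Lemma hcE (X Y Z : C) (g g' : hom Y Z) (f f' : hom X Y)
  (b : cell (F1 F g) (F1 F g')) (a : cell (F1 F f) (F1 F f')) :
  hc b a • phi F g f = phi F g' f' • (b ⋆ a).
Proof. by rewrite hc_def -!vcompA iso_fwdK vcomp1r. Qed.

Lemma hc_uniq (X Y Z : C) (g g' : hom Y Z) (f f' : hom X Y)
  (b : cell (F1 F g) (F1 F g')) (a : cell (F1 F f) (F1 F f')) c :
  c • phi F g f = phi F g' f' • (b ⋆ a) -> hc b a = c.
Proof. by rewrite -hcE => /iso_epi. Qed.

Lemma hc_F2 (X Y Z : C) (g g' : hom Y Z) (f f' : hom X Y)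
  (b : cell g g') (a : cell f f') : hc (F2 F b) (F2 F a) = F2 F (b ⋆ a).
Proof. by apply: hc_uniq; rewrite phi_nat. Qed.

Lemma hc_id (X Y Z : C) (g : hom Y Z) (f : hom X Y) :
  hc (id2 (F1 F g)) (id2 (F1 F f)) = id2 (F1 F (g ⋅ f)).
Proof. by rewrite -!F2_id hc_F2 hcomp_id. Qed.

Lemma hc_v (X Y Z : C) (g g' g'' : hom Y Z) (f f' f'' : hom X Y)
  (b' : cell (F1 F g') (F1 F g'')) (b : cell (F1 F g) (F1 F g'))
  (a' : cell (F1 F f') (F1 F f'')) (a : cell (F1 F f) (F1 F f')) :
  hc (b' • b) (a' • a) = hc b' a' • hc b a.
Proof. by apply: hc_uniq; rewrite -vcompA hcE vcompA hcE -vcompA -hcomp_v. Qed.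

Lemma hc_assoc (X Y Z T : C) (h h' : hom Z T) (g g' : hom Y Z) (f f' : hom X Y)
  (c : cell (F1 F h) (F1 F h')) (b : cell (F1 F g) (F1 F g'))
  (a : cell (F1 F f) (F1 F f')) :
  F2 F (assoc h' g' f') • hc (hc c b) a
  = hc c (hc b a) • F2 F (assoc h g f).
Proof.
apply: (@iso_epi _ _ _ _ _ _
  (iso_comp (phi F (h ⋅ g) f) (iso_hcomp (phi F h g) (iso_id (F1 F f))))) => /=.
rewrite -!vcompA phi_assoc (eq_v (hcE _ _)) -!vcompA.
rewrite -hcomp_v hcE vcomp1r -[a in LHS]vcomp1l hcomp_v.
rewrite (eq_v3 (phi_assoc _ _ _ _)) -!vcompA assoc_nat.
rewrite (eq_v (hcE _ _)) -!vcompA; f_equal.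
by rewrite !vcompA -!hcomp_v hcE vcomp1r vcomp1l.
Qed.

Lemma hc_lunit (X Y : C) (f f' : hom X Y) (a : cell (F1 F f) (F1 F f')) :
  F2 F (lunit f') • hc (id2 (F1 F (id1 Y))) a = a • F2 F (lunit f).
Proof.
apply: (@iso_epi _ _ _ _ _ _
  (iso_comp (phi F (id1 Y) f) (iso_hcomp (xi F Y) (iso_id (F1 F f))))) => /=.
rewrite -!vcompA phi_lunit (eq_v (hcE _ _)) -!vcompA -hcomp_rl hcomp_lr.
by rewrite -lunit_nat (eq_v3 (phi_lunit _ _)).
Qed.

Lemma hc_runit (X Y : C) (f f' : hom X Y) (a : cell (F1 F f) (F1 F f')) :
  F2 F (runit f') • hc a (id2 (F1 F (id1 X))) = a • F2 F (runit f).
Proof.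
apply: (@iso_epi _ _ _ _ _ _
  (iso_comp (phi F f (id1 X)) (iso_hcomp (iso_id (F1 F f)) (xi F X)))) => /=.
rewrite -!vcompA phi_runit (eq_v (hcE _ _)) -!vcompA -hcomp_lr hcomp_rl.
by rewrite -runit_nat (eq_v3 (phi_runit _ _)).
Qed.

End ImageCells.

Section Homotopies.
Variables (C : bicat) (W : arrow_family C).

Record cylinder (X : C) := Cylinder {
  cW : C;
  cZ : C;
  d0 : hom X cW;
  d1 : hom X cW;
  cx : hom X cZ;
  cs : hom cW cZ;
  cs_W : W cs;
  alpha0 : iso2 (cs ⋅ d0) cx;
  alpha1 : iso2 (cs ⋅ d1) cx }.

Definition alpha (X : C) (K : cylinder X) : cell (cs K ⋅ d0 K) (cs K ⋅ d1 K) :=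
  (alpha1 K)^-1 • alpha0 K.

Record homotopy (X Y : C) (f g : hom X Y) := Homotopy {
  hcyl : cylinder X;
  hh : hom (cW hcyl) Y;
  heta : cell f (hh ⋅ d0 hcyl);
  heps : cell (hh ⋅ d1 hcyl) g }.

(* The associators that are tacit in [r * (h * d0) = (r * h) * d0] and in
   [s * (d0 * l) = (s * d0) * l] are inserted here and in [cyl_whr]. *)
Definition hom_whl (X Y Y' : C) (r : hom Y Y') (f g : hom X Y) (H : homotopy f g) :
  homotopy (r ⋅ f) (r ⋅ g) :=
  @Homotopy X Y' (r ⋅ f) (r ⋅ g) (hcyl H) (r ⋅ hh H)
    ((assoc r (hh H) (d0 (hcyl H)))^-1 • (id2 r ⋆ heta H))
    ((id2 r ⋆ heps H) • assoc r (hh H) (d1 (hcyl H))).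

Definition cyl_whr (X' X : C) (K : cylinder X) (l : hom X' X) : cylinder X' :=
  @Cylinder X' (cW K) (cZ K) (d0 K ⋅ l) (d1 K ⋅ l) (cx K ⋅ l) (cs K) (cs_W K)
    (iso_comp (iso_hcomp (alpha0 K) (iso_id l)) (iso_sym (assoc (cs K) (d0 K) l)))
    (iso_comp (iso_hcomp (alpha1 K) (iso_id l)) (iso_sym (assoc (cs K) (d1 K) l))).

Definition hom_whr (X' X Y : C) (f g : hom X Y) (H : homotopy f g) (l : hom X' X) :
  homotopy (f ⋅ l) (g ⋅ l) :=
  @Homotopy X' Y (f ⋅ l) (g ⋅ l) (cyl_whr (hcyl H) l) (hh H)
    (assoc (hh H) (d0 (hcyl H)) l • (heta H ⋆ id2 l))
    ((heps H ⋆ id2 l) • (assoc (hh H) (d1 (hcyl H)) l)^-1).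

(* Nonempty composable sequences of homotopies; [hcons H s] performs [H] after
   [s]. *)
Inductive hseq (X Y : C) : hom X Y -> hom X Y -> Type :=
| hone : forall f g : hom X Y, homotopy f g -> hseq f g
| hcons : forall f g h : hom X Y, homotopy g h -> hseq f g -> hseq f h.

Fixpoint happ (X Y : C) (f g h : hom X Y) (s : hseq g h) (t : hseq f g) : hseq f h :=
  match s in hseq g h return hseq f g -> hseq f h with
  | hone H => fun t => hcons H t
  | hcons H s' => fun t => hcons H (happ s' t)
  end t.

Fixpoint hseq_whl (X Y Y' : C) (r : hom Y Y') (f g : hom X Y) (s : hseq f g) :
  hseq (r ⋅ f) (r ⋅ g) :=
  match s in hseq f g return hseq (r ⋅ f) (r ⋅ g) with
  | hone H => hone (hom_whl r H)
  | hcons H s' => hcons (hom_whl r H) (hseq_whl r s')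
  end.

Fixpoint hseq_whr (X' X Y : C) (f g : hom X Y) (s : hseq f g) (l : hom X' X) :
  hseq (f ⋅ l) (g ⋅ l) :=
  match s in hseq f g return hseq (f ⋅ l) (g ⋅ l) with
  | hone H => hone (hom_whr H l)
  | hcons H s' => hcons (hom_whr H l) (hseq_whr s' l)
  end.

Section Hat.
Variables (D : bicat) (F : psfun C D).
Hypothesis HF : maps_into F W (@quasiequivalence D).

Lemma hatC_ex (X : C) (K : cylinder X) :
  exists c : cell (F1 F (d0 K)) (F1 F (d1 K)),
    phi F (cs K) (d1 K) • (id2 (F1 F (cs K)) ⋆ c)
    = F2 F (alpha K) • phi F (cs K) (d0 K).
Proof.
have [_ full] := proj1 (HF (cs_W K) (F X)) (F1 F (d0 K)) (F1 F (d1 K)).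
have [c Ec] := full
  ((phi F (cs K) (d1 K))^-1 • F2 F (alpha K) • phi F (cs K) (d0 K)).
by exists c; rewrite Ec vcompA iso_invK vcomp1l.
Qed.

(* When [F] is a 2-functor the [phi] are identities and the equation reads
   [F s * hatC = F alpha]. *)
Definition hatC (X : C) (K : cylinder X) : cell (F1 F (d0 K)) (F1 F (d1 K)) :=
  proj1_sig (constructive_indefinite_description _ (hatC_ex K)).

Lemma hatCE (X : C) (K : cylinder X) :
  phi F (cs K) (d1 K) • (id2 (F1 F (cs K)) ⋆ hatC K)
  = F2 F (alpha K) • phi F (cs K) (d0 K).
Proof. by rewrite /hatC; case: constructive_indefinite_description. Qed.

Lemma hatC_uniq (X : C) (K : cylinder X) (c : cell (F1 F (d0 K)) (F1 F (d1 K))) :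
  phi F (cs K) (d1 K) • (id2 (F1 F (cs K)) ⋆ c)
  = F2 F (alpha K) • phi F (cs K) (d0 K) -> hatC K = c.
Proof.
rewrite -hatCE => /iso_mono E.
have [inj _] := proj1 (HF (cs_W K) (F X)) (F1 F (d0 K)) (F1 F (d1 K)).
exact: inj (eq_sym E).
Qed.

Definition hatH (X Y : C) (f g : hom X Y) (H : homotopy f g) :
  cell (F1 F f) (F1 F g) :=
  F2 F (heps H) • phi F (hh H) (d1 (hcyl H))
    • (id2 (F1 F (hh H)) ⋆ hatC (hcyl H))
    • (phi F (hh H) (d0 (hcyl H)))^-1 • F2 F (heta H).

Fixpoint hatS (X Y : C) (f g : hom X Y) (s : hseq f g) : cell (F1 F f) (F1 F g) :=
  match s in hseq f g return cell (F1 F f) (F1 F g) with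
  | hone H => hatH H
  | hcons H s' => hatH H • hatS s'
  end.

Lemma hatHE (X Y : C) (f g : hom X Y) (H : homotopy f g) :
  hatH H = F2 F (heps H) • hc (id2 (F1 F (hh H))) (hatC (hcyl H)) • F2 F (heta H).
Proof. by rewrite /hatH hc_def -!vcompA. Qed.

Lemma hatH_whl (X Y Y' : C) (r : hom Y Y') (f g : hom X Y) (H : homotopy f g) :
  hatH (hom_whl r H) = hc (id2 (F1 F r)) (hatH H).
Proof.
rewrite !hatHE /= !F2_v -!hc_F2 F2_id.
have E Z (h h1 h2 : hom Z Y) (b : cell (F1 F h1) (F1 F h2))
  (a : cell (F1 F h) (F1 F h1)) :
  hc (id2 (F1 F r)) (b • a) = hc (id2 (F1 F r)) b • hc (id2 (F1 F r)) a.
  by rewrite -hc_v vcomp1l.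
rewrite !E -!vcompA -(hc_id F r) (eq_v (hc_assoc _ _ _)) -!vcompA.
by rewrite (vcompA (F2 F (assoc _ _ _))) -F2_v iso_invK F2_id vcomp1l.
Qed.

Lemma hatC_whr (X' X : C) (K : cylinder X) (l : hom X' X) :
  hatC (cyl_whr K l) = hc (hatC K) (id2 (F1 F l)).
Proof.
apply: hatC_uniq; cbn [cyl_whr cs d0 d1]; rewrite -hcE; f_equal.
have -> : alpha (cyl_whr K l)
  = assoc (cs K) (d1 K) l • (alpha K ⋆ id2 l) • (assoc (cs K) (d0 K) l)^-1.
  by rewrite /alpha /= whr_v -!vcompA.
rewrite !F2_v -hc_F2 F2_id.
have -> : F2 F (alpha K) = hc (id2 (F1 F (cs K))) (hatC K).
  by symmetry; apply: hc_uniq; rewrite hatCE.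
by rewrite vcompA hc_assoc -vcompA -F2_v iso_invK F2_id vcomp1r.
Qed.

Lemma hatH_whr (X' X Y : C) (f g : hom X Y) (H : homotopy f g) (l : hom X' X) :
  hatH (hom_whr H l) = hc (hatH H) (id2 (F1 F l)).
Proof.
rewrite !hatHE /= !F2_v -!hc_F2 F2_id hatC_whr.
have E Z (h h1 h2 : hom X Z) (b : cell (F1 F h1) (F1 F h2))
  (a : cell (F1 F h) (F1 F h1)) :
  hc (b • a) (id2 (F1 F l)) = hc b (id2 (F1 F l)) • hc a (id2 (F1 F l)).
  by rewrite -hc_v vcomp1l.
rewrite !E -!vcompA (vcompA (hc _ (hc _ _))) -hc_assoc -!vcompA.
by rewrite (vcompA (F2 F (assoc _ _ _)^-1)) -F2_v iso_fwdK F2_id vcomp1l.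
Qed.

Lemma hatS_app (X Y : C) (f g h : hom X Y) (s : hseq g h) (t : hseq f g) :
  hatS (happ s t) = hatS s • hatS t.
Proof. by elim: s t => //= f1 g1 h1 H s IH t; rewrite IH vcompA. Qed.

Lemma hatS_whl (X Y Y' : C) (r : hom Y Y') (f g : hom X Y) (s : hseq f g) :
  hatS (hseq_whl r s) = hc (id2 (F1 F r)) (hatS s).
Proof.
elim: s => /= *; rewrite hatH_whl //.
by rewrite -[id2 (F1 F r) in RHS]vcomp1l hc_v; f_equal; rewrite ?vcomp1l.
Qed.

Lemma hatS_whr (X' X Y : C) (f g : hom X Y) (s : hseq f g) (l : hom X' X) :
  hatS (hseq_whr s l) = hc (hatS s) (id2 (F1 F l)).
Proof.
elim: s => /= *; rewrite hatH_whr //.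
by rewrite -[id2 (F1 F l) in RHS]vcomp1l hc_v; f_equal; rewrite ?vcomp1l.
Qed.

End Hat.

(* [D] ranges over the bicategories of the (single, impredicatively quantified
   over) universe level of [bicat], which also contains [Ho] and [Hom]. *)
Definition hseq_equiv (X Y : C) (f g : hom X Y) (s t : hseq f g) : Prop :=
  forall (D : bicat) (F : psfun C D), is_2functor F ->
  forall HF : maps_into F W (@quasiequivalence D), hatS HF s = hatS HF t.

(* An equivalence class is the predicate satisfied by its members. *)
Definition ho_cell (X Y : C) (f g : hom X Y) : Type :=
  {P : hseq f g -> Prop | exists s, P = hseq_equiv s}.

Definition ho_class (X Y : C) (f g : hom X Y) (s : hseq f g) : ho_cell f g :=
  exist _ (hseq_equiv s) (ex_intro _ s eq_refl).

Definition ho_repr (X Y : C) (f g : hom X Y) (p : ho_cell f g) : hseq f g :=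
  proj1_sig (constructive_indefinite_description _ (proj2_sig p)).

Lemma ho_reprK (X Y : C) (f g : hom X Y) (p : ho_cell f g) :
  ho_class (ho_repr p) = p.
Proof.
case: p => P [s E]; rewrite /ho_repr /=.
case: constructive_indefinite_description => t Et /=.
by apply: eq_exist_uncurried; exists (eq_sym Et); apply: proof_irrelevance.
Qed.

Lemma ho_classP (X Y : C) (f g : hom X Y) (s t : hseq f g) :
  ho_class s = ho_class t <-> hseq_equiv s t.
Proof.
split=> [[E]|E].
  have : hseq_equiv t t by move=> D F sF HF.
  by rewrite -E.
have E' : hseq_equiv s = hseq_equiv t.
  apply: functional_extensionality => u; apply: propositional_extensionality.
  split=> E2 D F sF HF; first by rewrite -(E D F sF HF) (E2 D F sF HF).
  by rewrite (E D F sF HF) (E2 D F sF HF).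
by apply: eq_exist_uncurried; exists E'; apply: proof_irrelevance.
Qed.

Section HoEval.
Variables (D : bicat) (F : psfun C D) (sF : is_2functor F).
Hypothesis HF : maps_into F W (@quasiequivalence D).

Definition ho_eval (X Y : C) (f g : hom X Y) (p : ho_cell f g) :
  cell (F1 F f) (F1 F g) := hatS HF (ho_repr p).

Lemma ho_eval_class (X Y : C) (f g : hom X Y) (s : hseq f g) :
  ho_eval (ho_class s) = hatS HF s.
Proof. by have E := proj1 (ho_classP _ _) (ho_reprK (ho_class s)); exact: (E D F sF HF). Qed.

End HoEval.

Lemma ho_ext (X Y : C) (f g : hom X Y) (p q : ho_cell f g) :
  (forall (D : bicat) (F : psfun C D), is_2functor F ->
   forall HF : maps_into F W (@quasiequivalence D), ho_eval HF p = ho_eval HF q) ->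
  p = q.
Proof. by move=> E; rewrite -(ho_reprK p) -(ho_reprK q); apply (proj2 (ho_classP _ _)). Qed.

Definition ho_v (X Y : C) (f g h : hom X Y) (q : ho_cell g h) (p : ho_cell f g) :
  ho_cell f h := ho_class (happ (ho_repr q) (ho_repr p)).

Definition ho_whl (X Y Z : C) (r : hom Y Z) (f g : hom X Y) (p : ho_cell f g) :
  ho_cell (r ⋅ f) (r ⋅ g) := ho_class (hseq_whl r (ho_repr p)).

Definition ho_whr (X Y Z : C) (f g : hom Y Z) (p : ho_cell f g) (l : hom X Y) :
  ho_cell (f ⋅ l) (g ⋅ l) := ho_class (hseq_whr (ho_repr p) l).

(* The horizontal composition determined by the whiskerings. *)
Definition ho_h (X Y Z : C) (g g' : hom Y Z) (f f' : hom X Y)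
  (q : ho_cell g g') (p : ho_cell f f') : ho_cell (g ⋅ f) (g' ⋅ f') :=
  ho_v (ho_whr q f') (ho_whl g p).

Hypothesis W_id : contains_ids W.

Definition cyl_id (X : C) : cylinder X :=
  @Cylinder X X X (id1 X) (id1 X) (id1 X) (id1 X) (W_id X)
    (lunit (id1 X)) (lunit (id1 X)).

Definition htpy_of_cell (X Y : C) (f g : hom X Y) (m : cell f g) : homotopy f g :=
  @Homotopy X Y f g (cyl_id X) g ((runit g)^-1 • m) (runit g).

Definition ho_of_cell (X Y : C) (f g : hom X Y) (m : cell f g) : ho_cell f g :=
  ho_class (hone (htpy_of_cell m)).

Section HoEvalOps.
Variables (D : bicat) (F : psfun C D) (sF : is_2functor F).
Hypothesis HF : maps_into F W (@quasiequivalence D).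

Lemma ho_eval_v (X Y : C) (f g h : hom X Y) (q : ho_cell g h) (p : ho_cell f g) :
  ho_eval HF (ho_v q p) = ho_eval HF q • ho_eval HF p.
Proof. by rewrite /ho_v ho_eval_class // hatS_app. Qed.

Lemma ho_eval_whl (X Y Z : C) (r : hom Y Z) (f g : hom X Y) (p : ho_cell f g) :
  ho_eval HF (ho_whl r p) = hc (id2 (F1 F r)) (ho_eval HF p).
Proof. by rewrite /ho_whl ho_eval_class // hatS_whl. Qed.

Lemma ho_eval_whr (X Y Z : C) (f g : hom Y Z) (p : ho_cell f g) (l : hom X Y) :
  ho_eval HF (ho_whr p l) = hc (ho_eval HF p) (id2 (F1 F l)).
Proof. by rewrite /ho_whr ho_eval_class // hatS_whr. Qed.

Lemma ho_eval_h (X Y Z : C) (g g' : hom Y Z) (f f' : hom X Y)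
  (q : ho_cell g g') (p : ho_cell f f') :
  ho_eval HF (ho_h q p) = hc (ho_eval HF q) (ho_eval HF p).
Proof.
by rewrite /ho_h ho_eval_v ho_eval_whl ho_eval_whr -hc_v vcomp1l vcomp1r.
Qed.

Lemma hatC_id (X : C) : hatC HF (cyl_id X) = id2 (F1 F (id1 X)).
Proof.
apply: hatC_uniq; rewrite /alpha /=.
by rewrite hcomp_id vcomp1r iso_fwdK F2_id vcomp1l.
Qed.

Lemma ho_eval_cell (X Y : C) (f g : hom X Y) (m : cell f g) :
  ho_eval HF (ho_of_cell m) = F2 F m.
Proof.
rewrite /ho_of_cell ho_eval_class //= hatHE /= hatC_id hc_id vcomp1l.
by rewrite -F2_v vcompA iso_invK vcomp1l.
Qed.

End HoEvalOps.

Lemma ho_v_class (X Y : C) (f g h : hom X Y) (s : hseq g h) (t : hseq f g) :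
  ho_v (ho_class s) (ho_class t) = ho_class (happ s t).
Proof.
by apply: ho_ext => D F sF HF; rewrite ho_eval_v // !ho_eval_class // hatS_app.
Qed.

Lemma ho_whl_class (X Y Z : C) (r : hom Y Z) (f g : hom X Y) (s : hseq f g) :
  ho_whl r (ho_class s) = ho_class (hseq_whl r s).
Proof.
by apply: ho_ext => D F sF HF; rewrite ho_eval_whl // !ho_eval_class // hatS_whl.
Qed.

Lemma ho_whr_class (X Y Z : C) (f g : hom Y Z) (s : hseq f g) (l : hom X Y) :
  ho_whr (ho_class s) l = ho_class (hseq_whr s l).
Proof.
by apply: ho_ext => D F sF HF; rewrite ho_eval_whr // !ho_eval_class // hatS_whr.
Qed.

Definition ho_data : bicat_data :=
  @BicatData C (fun X Y => hom X Y) (fun X Y f g => ho_cell f g)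
    (fun X => id1 X) (fun X Y Z g f => g ⋅ f)
    (fun X Y f => ho_of_cell (id2 f)) ho_v ho_h.

Lemma ho_of_cell_v (X Y : C) (f g h : hom X Y) (b : cell g h) (a : cell f g) :
  ho_of_cell (b • a) = ho_v (ho_of_cell b) (ho_of_cell a).
Proof.
by apply: ho_ext => D F sF HF; rewrite ho_eval_v // !ho_eval_cell // F2_v.
Qed.

Lemma ho_of_cell_h (X Y Z : C) (g g' : hom Y Z) (f f' : hom X Y)
  (b : cell g g') (a : cell f f') :
  ho_of_cell (b ⋆ a) = ho_h (ho_of_cell b) (ho_of_cell a).
Proof.
by apply: ho_ext => D F sF HF; rewrite ho_eval_h // !ho_eval_cell // hc_F2.
Qed.

Lemma ho_of_isoK (X Y : C) (f g : hom X Y) (i : iso2 f g) :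
  ho_v (ho_of_cell i^-1) (ho_of_cell i) = ho_of_cell (id2 f).
Proof. by rewrite -ho_of_cell_v iso_fwdK. Qed.

Lemma ho_of_isoVK (X Y : C) (f g : hom X Y) (i : iso2 f g) :
  ho_v (ho_of_cell i) (ho_of_cell i^-1) = ho_of_cell (id2 g).
Proof. by rewrite -ho_of_cell_v iso_invK. Qed.

Definition ho_of_iso (X Y : C) (f g : hom X Y) (i : iso2 f g) :
  @iso2 ho_data X Y f g :=
  @Iso2 ho_data X Y f g (ho_of_cell i) (ho_of_cell i^-1)
    (ho_of_isoK i) (ho_of_isoVK i).

Definition Ho : bicat.
Proof.
refine (@Bicat ho_data
  (fun X Y Z T h g f => ho_of_iso (assoc h g f))
  (fun X Y f => ho_of_iso (lunit f)) (fun X Y f => ho_of_iso (runit f))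
  _ _ _ _ _ _ _ _ _ _); cbn.
- abstract by move=> *; apply: ho_ext => D F sF HF;
    rewrite !ho_eval_v // vcompA.
- abstract by move=> *; apply: ho_ext => D F sF HF;
    rewrite !ho_eval_v // ho_eval_cell // F2_id vcomp1l.
- abstract by move=> *; apply: ho_ext => D F sF HF;
    rewrite !ho_eval_v // ho_eval_cell // F2_id vcomp1r.
- abstract by move=> *; rewrite -ho_of_cell_h hcomp_id.
- abstract by move=> *; apply: ho_ext => D F sF HF;
    rewrite !(ho_eval_h, ho_eval_v) // hc_v.
- abstract by move=> *; apply: ho_ext => D F sF HF;
    rewrite !(ho_eval_h, ho_eval_v, ho_eval_cell) // hc_assoc.
- abstract by move=> *; apply: ho_ext => D F sF HF;
    rewrite !(ho_eval_h, ho_eval_v, ho_eval_cell) // F2_id hc_lunit.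
- abstract by move=> *; apply: ho_ext => D F sF HF;
    rewrite !(ho_eval_h, ho_eval_v, ho_eval_cell) // F2_id hc_runit.
- abstract by move=> *; rewrite -!ho_of_cell_h -!ho_of_cell_v pentagon.
- abstract by move=> *; rewrite -!ho_of_cell_h -!ho_of_cell_v triangle.
Defined.

Definition ho_i : psfun C Ho.
Proof.
refine (@Psfun C Ho (fun X => X) (fun X Y f => f) (fun X Y f g m => ho_of_cell m)
  (fun X Y Z g f => @iso_id Ho X Z (g ⋅ f)) (fun X => @iso_id Ho X X (id1 X))
  _ _ _ _ _ _).
- abstract by [].
- abstract by move=> *; apply: ho_of_cell_v.
- abstract by move=> *; rewrite vcomp1l vcomp1r; exact: eq_sym (ho_of_cell_h _ _).
- abstract by move=> *; rewrite !hcomp_id !vcomp1r !vcomp1l.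
- abstract by move=> *; rewrite hcomp_id !vcomp1r.
- abstract by move=> *; rewrite hcomp_id !vcomp1r.
Defined.

Lemma ho_i_2functor : is_2functor ho_i.
Proof. by split=> *; apply: is_identity_id2. Qed.

Lemma ho_i_precomp_maps (D : bicat) (G : psfun Ho D) :
  maps_into G (image_family ho_i W) (@equivalence D) ->
  maps_into (psfun_comp G ho_i) W (@equivalence D).
Proof. by move=> HG X Y f Wf; apply: HG; apply: (@image_intro C Ho ho_i W X Y f Wf). Qed.

Definition ho_i_star (D : bicat) :
  psfun (Hom_equiv (image_family ho_i W) D) (Hom_equiv W D) :=
  psfun_restrict (F := precomp D ho_i) (@ho_i_precomp_maps D).

End Homotopies.

(* Main.v *)
(** A pseudofunctor [F : C -> D] factors as a 2-functor [C -> F(C)] followed by a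
    locally fully faithful pseudofunctor, where [F(C)] has the objects and arrows
    of [C] and the 2-cells of [D] between images of arrows.  If [F] sends [W] to
    quasiequivalences then so does [C -> F(C)]; hence sequences of homotopies that
    are equivalent with respect to 2-functors have the same value under [F], and
    [F] extends to [Ho].  The extension is unique because in [Ho] the class of a
    homotopy is [i eps • (h ⋆ c) • i eta], where the 2-cell [c] is determined by
    [s ⋆ c = i alpha].  A pseudonatural transformation [t : F => G] is natural with
    respect to all the 2-cells of [Ho], since naturality at [c] can be tested after
    whiskering with the quasiequivalence [G s]; modifications involve no 2-cells
    of the source, so they extend as they are.  The two passages are mutually
    inverse on the nose. *)

Require Import Defs.
From Stdlib Require Import ssreflect.
From Stdlib Require Import FunctionalExtensionality ProofIrrelevance JMeq.

Set Implicit Arguments.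
Unset Strict Implicit.
Unset Printing Implicit Defensive.

(** * Equivalences are quasiequivalences *)

Lemma conj_isoK (B : bicat) (X Y : B) (f g h k : hom X Y) (i : iso2 f g)
  (b : cell h k) (a : cell f h) : (b • a • i^-1) • i = b • a.
Proof. by rewrite -!vcompA iso_fwdK vcomp1r. Qed.

Section EquivalenceQuasi.
Variables (B : bicat) (X Y : B).

Definition cancel_l (f : hom X Y) (g : hom Y X) (i : iso2 (g ⋅ f) (id1 X))
  (Z : B) (a : hom Z X) : iso2 (g ⋅ (f ⋅ a)) a :=
  iso_comp (lunit a) (iso_comp (iso_hcomp i (iso_id a)) (iso_sym (assoc g f a))).

Lemma cancel_l_nat (f : hom X Y) (g : hom Y X) (i : iso2 (g ⋅ f) (id1 X))
  (Z : B) (a b : hom Z X) (c : cell a b) :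
  cancel_l i b • (id2 g ⋆ (id2 f ⋆ c)) = c • cancel_l i a.
Proof. by cbn; coh; coh_nat E i c k; exact: E. Qed.

Definition cancel_r (f : hom X Y) (g : hom Y X) (i : iso2 (f ⋅ g) (id1 Y))
  (Z : B) (a : hom Y Z) : iso2 ((a ⋅ f) ⋅ g) a :=
  iso_comp (runit a) (iso_comp (iso_hcomp (iso_id a) i) (assoc a f g)).

Lemma cancel_r_nat (f : hom X Y) (g : hom Y X) (i : iso2 (f ⋅ g) (id1 Y))
  (Z : B) (a b : hom Y Z) (c : cell a b) :
  cancel_r i b • ((c ⋆ id2 f) ⋆ id2 g) = c • cancel_r i a.
Proof. by cbn; coh; coh_nat E c i k; exact: eq_sym E. Qed.

End EquivalenceQuasi.

Lemma cancel_l_inj (B : bicat) (X Y Z : B) (f : hom X Y) (g : hom Y X)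
  (i : iso2 (g ⋅ f) (id1 X)) (a b : hom Z X) (c c' : cell a b) :
  id2 f ⋆ c = id2 f ⋆ c' -> c = c'.
Proof.
by move=> E; apply: (iso_epi (i := cancel_l i a)); rewrite -!cancel_l_nat E.
Qed.

Lemma cancel_r_inj (B : bicat) (X Y Z : B) (f : hom X Y) (g : hom Y X)
  (i : iso2 (f ⋅ g) (id1 Y)) (a b : hom Y Z) (c c' : cell a b) :
  c ⋆ id2 f = c' ⋆ id2 f -> c = c'.
Proof.
by move=> E; apply: (iso_epi (i := cancel_r i a)); rewrite -!cancel_r_nat E.
Qed.

Lemma equivalence_quasi (B : bicat) (X Y : B) (f : hom X Y) :
  equivalence f -> quasiequivalence f.
Proof.
case=> g [[i] [j]] Z; split=> a b; split.
- by move=> c c'; apply: (cancel_l_inj i).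
(* The preimage is [d] whiskered with [g] and transported along [cancel_l i]. That it maps to [d] is
   tested after whiskering with [g], which is faithful because of [j]. *)
- move=> d; exists (cancel_l i b • (id2 g ⋆ d) • (cancel_l i a)^-1).
  apply: (cancel_l_inj j); apply: (iso_mono (i := cancel_l i b)).
  by rewrite cancel_l_nat conj_isoK.
- by move=> c c'; apply: (cancel_r_inj j).
- move=> d; exists (cancel_r j b • (d ⋆ id2 g) • (cancel_r j a)^-1).
  apply: (cancel_r_inj i); apply: (iso_mono (i := cancel_r j b)).
  by rewrite cancel_r_nat conj_isoK.
Qed.

Lemma equivalence_id1 (B : bicat) (X : B) : equivalence (id1 X).
Proof. by exists (id1 X); split; constructor; exact: lunit. Qed.

(** * The bicategory of 2-cells between images of arrows *)

Section ImageBicat.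
Variables (C D : bicat) (F : psfun C D).

Definition image_data : bicat_data :=
  @BicatData C (fun X Y => hom X Y) (fun X Y f g => cell (F1 F f) (F1 F g))
    (fun X => id1 X) (fun X Y Z g f => g ⋅ f)
    (fun X Y f => id2 (F1 F f)) (fun X Y f g h b a => b • a)
    (fun X Y Z g g' f f' b a => hc b a).

Definition image_iso (X Y : C) (f g : hom X Y) (i : iso2 f g) :
  @iso2 image_data X Y f g :=
  @Iso2 image_data X Y f g (F2 F i) (F2 F i^-1) (F2_isoK F i) (F2_isoVK F i).

Definition image_bicat : bicat.
Proof.
refine (@Bicat image_data
  (fun X Y Z T h g f => image_iso (assoc h g f))
  (fun X Y f => image_iso (lunit f)) (fun X Y f => image_iso (runit f))
  _ _ _ _ _ _ _ _ _ _); cbn.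
- abstract by move=> *; apply: vcompA.
- abstract by move=> *; apply: vcomp1l.
- abstract by move=> *; apply: vcomp1r.
- abstract by move=> *; apply: hc_id.
- abstract by move=> *; apply: hc_v.
- abstract by move=> *; apply: hc_assoc.
- abstract by move=> *; apply: hc_lunit.
- abstract by move=> *; apply: hc_runit.
- abstract by move=> *; rewrite -!F2_id !hc_F2 -!F2_v pentagon.
- abstract by move=> *; rewrite -!F2_id !hc_F2 -!F2_v triangle.
Defined.

Definition image_psfun : psfun C image_bicat.
Proof.
refine (@Psfun C image_bicat (fun X => X) (fun X Y f => f)
  (fun X Y f g a => F2 F a)
  (fun X Y Z g f => @iso_id image_bicat X Z (g ⋅ f))
  (fun X => @iso_id image_bicat X X (id1 X)) _ _ _ _ _ _); cbn.
- abstract by move=> *; apply: F2_id.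
- abstract by move=> *; apply: F2_v.
- abstract by move=> *; rewrite hc_F2 vcomp1l vcomp1r.
- abstract by move=> *; rewrite !hc_id !vcomp1l !vcomp1r.
- abstract by move=> *; rewrite hc_id !vcomp1r.
- abstract by move=> *; rewrite hc_id !vcomp1r.
Defined.

Lemma image_psfun_2functor : is_2functor image_psfun.
Proof. by split=> *; apply: is_identity_id2. Qed.

(** Whiskering in [image_bicat] is whiskering in [D] conjugated by the invertible [phi], so fullness
    and faithfulness carry over from [D], tested at the objects [F Z]. *)
Lemma image_psfun_quasi (W : arrow_family C) :
  maps_into F W (@quasiequivalence D) ->
  maps_into image_psfun W (@quasiequivalence image_bicat).
Proof.
move=> HF X Y f Wf Z; split=> a b; split; cbn.
- move=> c c'; rewrite !hc_def => /iso_mono E.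
  apply: (proj1 (proj1 (HF _ _ _ Wf _) _ _)).
  exact: (iso_epi (i := iso_sym (phi F f a))) E.
- move=> d.
  have [c Ec] := proj2 (proj1 (HF _ _ _ Wf (F Z)) _ _)
    ((phi F f b)^-1 • d • phi F f a).
  by exists c; apply: hc_uniq; rewrite Ec vcompA iso_invK vcomp1l.
- move=> c c'; rewrite !hc_def => /iso_mono E.
  apply: (proj1 (proj2 (HF _ _ _ Wf _) _ _)).
  exact: (iso_epi (i := iso_sym (phi F a f))) E.
- move=> d.
  have [c Ec] := proj2 (proj2 (HF _ _ _ Wf (F Z)) _ _)
    ((phi F b f)^-1 • d • phi F a f).
  by exists c; apply: hc_uniq; rewrite Ec vcompA iso_invK vcomp1l.
Qed.

Lemma hc_image (X Y Z : C) (g g' : hom Y Z) (f f' : hom X Y)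
  (b : cell (F1 F g) (F1 F g')) (a : cell (F1 F f) (F1 F f')) :
  @hc C image_bicat image_psfun X Y Z g g' f f' b a = hc b a.
Proof. by apply: hc_uniq; cbn; rewrite vcomp1l vcomp1r. Qed.

Variables (W : arrow_family C) (HF : maps_into F W (@quasiequivalence D)).

(** In [image_bicat] the structural 2-cells are identities and [hc] absorbs those of [F], so both
    2-cells solve the same defining equation. *)
Lemma hatC_image (X : C) (K : cylinder W X) :
  hatC (image_psfun_quasi HF) K = hatC HF K.
Proof.
apply: hatC_uniq; cbn; rewrite vcomp1l vcomp1r.
by apply: hc_uniq; rewrite hatCE.
Qed.

Lemma hatS_image (X Y : C) (f g : hom X Y) (s : hseq W f g) :
  hatS (image_psfun_quasi HF) s = hatS HF s.
Proof.
have E h k (H : homotopy W h k) :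
  hatH (image_psfun_quasi HF) H = hatH HF H :> cell (F1 F h) (F1 F k).
  by rewrite !hatHE hatC_image hc_image.
by elim: s => [h k H|h k l H s IH] /=; rewrite E // IH.
Qed.

End ImageBicat.

(** * Extension of a pseudofunctor to [Ho] *)

Section Extension.
Variables (C D : bicat) (W : arrow_family C) (W_id : contains_ids W).
Variables (F : psfun C D) (HF : maps_into F W (@quasiequivalence D)).

(* Factoring through [image_psfun F] removes the assumption of [ho_eval_class]
   that [F] is a 2-functor. *)
Lemma ho_eval_hatS (X Y : C) (f g : hom X Y) (s : hseq W f g) :
  ho_eval HF (ho_class s) = hatS HF s.
Proof.
rewrite /ho_eval -(hatS_image HF s) -(hatS_image HF (ho_repr _)).
exact: (proj1 (ho_classP _ _) (ho_reprK (ho_class s)) _ _ (image_psfun_2functor F)).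
Qed.

Lemma ho_eval_vcomp (X Y : C) (f g h : hom X Y) (q : ho_cell W g h)
  (p : ho_cell W f g) : ho_eval HF (ho_v q p) = ho_eval HF q • ho_eval HF p.
Proof. by rewrite /ho_v ho_eval_hatS hatS_app. Qed.

Lemma ho_eval_hcomp (X Y Z : C) (g g' : hom Y Z) (f f' : hom X Y)
  (q : ho_cell W g g') (p : ho_cell W f f') :
  ho_eval HF (ho_h q p) = hc (ho_eval HF q) (ho_eval HF p).
Proof.
rewrite /ho_h ho_eval_vcomp !ho_eval_hatS hatS_whl hatS_whr -hc_v.
by rewrite vcomp1l vcomp1r.
Qed.

Lemma ho_eval_of_cell (X Y : C) (f g : hom X Y) (m : cell f g) :
  ho_eval HF (ho_of_cell W_id m) = F2 F m.
Proof.
rewrite /ho_of_cell ho_eval_hatS /= hatHE /= hatC_id hc_id vcomp1l.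
by rewrite -F2_v vcompA iso_invK vcomp1l.
Qed.

(** The structural 2-cells of [F] serve unchanged: associators and unitors of [Ho] come from [C],
    where [ho_eval] agrees with [F2 F]. *)
Definition extend : psfun (Ho W_id) D.
Proof.
refine (@Psfun (Ho W_id) D (fun X => F X) (fun X Y f => F1 F f)
  (fun X Y f g p => ho_eval HF p) (fun X Y Z g f => phi F g f)
  (fun X => xi F X) _ _ _ _ _ _); cbn.
- abstract by move=> *; rewrite ho_eval_of_cell F2_id.
- abstract by move=> *; apply: ho_eval_vcomp.
- abstract by move=> *; rewrite ho_eval_hcomp hcE.
- abstract by move=> *; rewrite ho_eval_of_cell phi_assoc.
- abstract by move=> *; rewrite ho_eval_of_cell phi_lunit.
- abstract by move=> *; rewrite ho_eval_of_cell phi_runit.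
Defined.

End Extension.

Arguments extend {C D W} W_id {F} HF.

(** * Pseudofunctors on [Ho] are determined by their restriction to [C] *)

Section ExtendPrecomp.
Variables (C D : bicat) (W : arrow_family C) (W_id : contains_ids W).
Variable H : psfun (Ho W_id) D.
Let Hi := psfun_comp H (ho_i W_id).
Hypothesis HHi : maps_into Hi W (@quasiequivalence D).

(* The 2-cell [c] with [s ⋆ c = i alpha]. *)
Definition ho_cyl (X : C) (K : cylinder W X) :
  @cell (Ho W_id) X (cW K) (d0 K) (d1 K) :=
  ho_class (hone (@Homotopy C W X (cW K) (d0 K) (d1 K) K (id1 (cW K))
    (lunit (d0 K))^-1 (lunit (d1 K)))).

Lemma ho_eval_cyl (E : bicat) (F : psfun C E)
  (HF : maps_into F W (@quasiequivalence E)) (X : C) (K : cylinder W X) :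
  ho_eval HF (ho_cyl K) = hatC HF K.
Proof.
rewrite ho_eval_hatS /= hatHE /= vcompA hc_lunit -vcompA.
by rewrite -F2_v iso_invK F2_id vcomp1r.
Qed.

Lemma ho_cyl_alpha (X : C) (K : cylinder W X) :
  @id2 (Ho W_id) _ _ (cs K) ⋆ ho_cyl K = ho_of_cell W_id (alpha K).
Proof.
apply: ho_ext => E F sF HF.
rewrite ho_eval_hcomp !ho_eval_of_cell ho_eval_cyl F2_id.
by apply: hc_uniq; rewrite hatCE.
Qed.

(** This is the formula for [hatH] with [ho_cyl] in place of [hatC]; every 2-functor that defines
    the classes gives both sides the same value. *)
Lemma ho_class_one (X Y : C) (f g : hom X Y) (K : homotopy W f g) :
  ho_class (hone K) = ho_v (ho_of_cell W_id (heps K))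
    (ho_v (ho_h (ho_of_cell W_id (id2 (hh K))) (ho_cyl (hcyl K)))
      (ho_of_cell W_id (heta K))).
Proof.
apply: ho_ext => E F sF HF.
rewrite !(ho_eval_vcomp, ho_eval_hcomp, ho_eval_of_cell) ho_eval_cyl.
by rewrite ho_eval_hatS F2_id /= hatHE.
Qed.

Lemma phi_precomp (X Y Z : C) (g : hom Y Z) (f : hom X Y) :
  iso_fwd (phi (psfun_comp H (ho_i W_id)) g f) = phi H g f.
Proof. by cbn; rewrite F2_id vcomp1l. Qed.

(** Applying [H] to [ho_cyl_alpha] yields the equation that characterizes [hatC], so uniqueness
    leaves no other value. *)
Lemma hatC_ho (X : C) (K : cylinder W X) : hatC HHi K = F2 H (ho_cyl K).
Proof.
apply: hatC_uniq; rewrite !phi_precomp.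
by have := phi_whl H (cs K) (ho_cyl K); rewrite ho_cyl_alpha.
Qed.

Lemma hatS_ho (X Y : C) (f g : hom X Y) (s : hseq W f g) :
  hatS HHi s = F2 H (ho_class s).
Proof.
have E1 h k (K : homotopy W h k) : hatH HHi K = F2 H (ho_class (hone K)).
  rewrite ho_class_one 2!F2_v hatHE hatC_ho.
  congr (_ • (_ • _)); apply: hc_uniq; rewrite !phi_precomp.
  by symmetry; exact: (phi_whl H (hh K) (ho_cyl (hcyl K))).
elim: s => [h k K|h k l K s IH] /=; first exact: E1.
have -> : ho_class (hcons K s) = ho_v (ho_class (hone K)) (ho_class s).
  by rewrite ho_v_class.
by rewrite E1 IH; symmetry; exact: (F2_v H).
Qed.

Lemma ho_eval_precomp (X Y : C) (f g : hom X Y) (p : ho_cell W f g) :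
  ho_eval HHi p = F2 H p.
Proof. by rewrite -(ho_reprK p) ho_eval_hatS hatS_ho. Qed.

End ExtendPrecomp.

(** * Extension of transformations and modifications *)

Section ExtendPnat.
Variables (C D : bicat) (F G : psfun C D) (t : pnat F G).

(** The factor of [t1_comp] that moves [t] past [s] alone. It is natural in arbitrary 2-cells of [D]
    between images of arrows, hence also in [hatC]. *)
Definition t1_whl (X Y Z : C) (s : hom Y Z) (f : hom X Y) :
  iso2 (F1 G s ⋅ (t Y ⋅ F1 F f)) (t Z ⋅ F1 F (s ⋅ f)) :=
  iso_comp (iso_hcomp (iso_id (t Z)) (phi F s f))
 (iso_comp (assoc (t Z) (F1 F s) (F1 F f))
 (iso_comp (iso_hcomp (t1 t s) (iso_id (F1 F f)))
   (iso_sym (assoc (F1 G s) (t Y) (F1 F f))))).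

Lemma t1_compE (X Y Z : C) (s : hom Y Z) (f : hom X Y) :
  t1 t (s ⋅ f) • (phi G s f ⋆ id2 (t X))
  = t1_whl s f • (id2 (F1 G s) ⋆ t1 t f) • assoc (F1 G s) (F1 G f) (t X).
Proof. by rewrite t1_comp /t1_whl /= -!vcompA. Qed.

Lemma t1_whl_nat (X Y Z : C) (s : hom Y Z) (f f' : hom X Y)
  (a : cell (F1 F f) (F1 F f')) :
  t1_whl s f' • (id2 (F1 G s) ⋆ (id2 (t Y) ⋆ a))
  = (id2 (t Z) ⋆ hc (id2 (F1 F s)) a) • t1_whl s f.
Proof.
rewrite /t1_whl /= [RHS]vcompA -whl_v hcE; coh.
by coh_nat E (t1 t s) a k; rewrite E.
Qed.

Definition t1_commutes (X Y : C) (f f' : hom X Y)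
  (a : cell (F1 F f) (F1 F f')) (b : cell (F1 G f) (F1 G f')) : Prop :=
  t1 t f' • (b ⋆ id2 (t X)) = (id2 (t Y) ⋆ a) • t1 t f.

Lemma t1_commutes_v (X Y : C) (f g h : hom X Y)
  (a' : cell (F1 F g) (F1 F h)) (b' : cell (F1 G g) (F1 G h))
  (a : cell (F1 F f) (F1 F g)) (b : cell (F1 G f) (F1 G g)) :
  t1_commutes a' b' -> t1_commutes a b -> t1_commutes (a' • a) (b' • b).
Proof.
rewrite /t1_commutes => E' E.
by rewrite whr_v whl_v vcompA E' -vcompA E vcompA.
Qed.

(** Up to invertible 2-cells the square at [s ⋅ f] is the square at [f] whiskered with [G s]. One
    direction lets [G s] be cancelled for a cylinder, the other handles whiskering with the arrow of
    a homotopy. *)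
Lemma t1_commutes_hcl (X Y Z : C) (s : hom Y Z) (f f' : hom X Y)
  (a : cell (F1 F f) (F1 F f')) (b : cell (F1 G f) (F1 G f')) :
  t1_commutes (hc (id2 (F1 F s)) a) (hc (id2 (F1 G s)) b)
  <-> id2 (F1 G s) ⋆ (t1 t f' • (b ⋆ id2 (t X)))
      = id2 (F1 G s) ⋆ ((id2 (t Y) ⋆ a) • t1 t f).
Proof.
have El : (t1 t (s ⋅ f') • (hc (id2 (F1 G s)) b ⋆ id2 (t X)))
    • iso_hcomp (phi G s f) (iso_id (t X))
  = t1_whl s f' • (id2 (F1 G s) ⋆ (t1 t f' • (b ⋆ id2 (t X))))
    • assoc (F1 G s) (F1 G f) (t X).
  rewrite /= -vcompA -whr_v hcE whr_v vcompA t1_compE whl_v -!vcompA.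
  by rewrite assoc_nat.
have Er : ((id2 (t Z) ⋆ hc (id2 (F1 F s)) a) • t1 t (s ⋅ f))
    • iso_hcomp (phi G s f) (iso_id (t X))
  = t1_whl s f' • (id2 (F1 G s) ⋆ ((id2 (t Y) ⋆ a) • t1 t f))
    • assoc (F1 G s) (F1 G f) (t X).
  by rewrite /= -vcompA t1_compE vcompA -t1_whl_nat whl_v -!vcompA.
rewrite /t1_commutes; split=> E.
  by move: El; rewrite E Er => /iso_mono /iso_epi ->.
apply: (iso_epi (i := iso_hcomp (phi G s f) (iso_id (t X)))).
by rewrite El E -Er.
Qed.

Variable W : arrow_family C.
Hypothesis HF : maps_into F W (@quasiequivalence D).
Hypothesis HG : maps_into G W (@quasiequivalence D).

Lemma t1_commutes_hatC (X : C) (K : cylinder W X) :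
  t1_commutes (hatC HF K) (hatC HG K).
Proof.
apply: (proj1 (proj1 (HG (cs_W K) _) _ _)).
apply/t1_commutes_hcl.
(* After whiskering with [s] both 2-cells become images of [alpha K], a 2-cell of [C], where [t] is
   natural by assumption. *)
have -> : hc (id2 (F1 F (cs K))) (hatC HF K) = F2 F (alpha K).
  by apply: hc_uniq; rewrite hatCE.
have -> : hc (id2 (F1 G (cs K))) (hatC HG K) = F2 G (alpha K).
  by apply: hc_uniq; rewrite hatCE.
exact: t1_nat.
Qed.

Lemma t1_commutes_hatS (X Y : C) (f g : hom X Y) (s : hseq W f g) :
  t1_commutes (hatS HF s) (hatS HG s).
Proof.
have E h k (H : homotopy W h k) : t1_commutes (hatH HF H) (hatH HG H).
  rewrite !hatHE; apply: t1_commutes_v; first exact: t1_nat.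
  apply: t1_commutes_v; last exact: t1_nat.
  by apply/t1_commutes_hcl; rewrite t1_commutes_hatC.
elim: s => [h k H|h k l H s IH] /=; first exact: E.
exact: t1_commutes_v.
Qed.

Hypothesis W_id : contains_ids W.

Definition extend_pnat : pnat (extend W_id HF) (extend W_id HG).
Proof.
refine (@Pnat (Ho W_id) D (extend W_id HF) (extend W_id HG)
  (fun X => t X) (fun X Y f => t1 t f) _ _ _).
(* [ho_eval] is [hatS] at a chosen representative, and the choice is the same for [F] and [G]. *)
- abstract by move=> X Y f g p; apply: t1_commutes_hatS.
- abstract exact: (@t1_id _ _ _ _ t).
- abstract exact: (@t1_comp _ _ _ _ t).
Defined.

End ExtendPnat.

Definition extend_modif (C D : bicat) (W : arrow_family C) (W_id : contains_ids W)
  (F G : psfun C D) (HF : maps_into F W (@quasiequivalence D))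
  (HG : maps_into G W (@quasiequivalence D)) (s t : pnat F G) (m : modif s t) :
  modif (extend_pnat s HF HG W_id) (extend_pnat t HF HG W_id) :=
  @Modif (Ho W_id) D _ _ (extend_pnat s HF HG W_id) (extend_pnat t HF HG W_id)
    (fun X => m X) (@m0_nat _ _ _ _ _ _ m).

(** * Extension as a pseudofunctor between Hom bicategories *)

Section ExtendHom.
Variables (C D : bicat) (W : arrow_family C) (W_id : contains_ids W).

Definition maps_into_quasi (F : psfun C D) (HF : maps_into F W (@equivalence D)) :
  maps_into F W (@quasiequivalence D) :=
  fun X Y f Wf => equivalence_quasi (HF X Y f Wf).

Lemma extend_maps (F : psfun C D) (HF : maps_into F W (@equivalence D)) :
  maps_into (extend W_id (maps_into_quasi HF)) (image_family (ho_i W_id) W)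
    (@equivalence D).
Proof. by move=> _ _ _ [X Y f Wf]; apply: HF. Qed.

Definition extend_ob (F : Hom_equiv W D) :
  Hom_equiv (image_family (ho_i W_id) W) D :=
  exist _ (extend W_id (maps_into_quasi (proj2_sig F))) (extend_maps (proj2_sig F)).

Definition extend_hom1 (F G : Hom_equiv W D) (t : hom F G) :
  hom (extend_ob F) (extend_ob G) := extend_pnat t _ _ W_id.

(** Source and target have the same components and differ only in the proofs of their axioms, so
    identity components give the isomorphism. *)
Definition extend_phi (F G H : Hom_equiv W D) (t : hom G H) (s : hom F G) :
  iso2 (extend_hom1 t ⋅ extend_hom1 s) (extend_hom1 (t ⋅ s)).
Proof.
apply: full_sub_iso.
apply: (@modif_iso (Ho W_id) D _ _
  (pnat_comp (extend_hom1 t) (extend_hom1 s)) (extend_hom1 (pnat_comp t s))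
  (fun X => iso_id (t0 t X ⋅ t0 s X))).
abstract by move=> X Y f; cbn; rewrite !hcomp_id vcomp1l vcomp1r.
Defined.

Definition extend_xi (F : Hom_equiv W D) :
  iso2 (id1 (extend_ob F)) (extend_hom1 (id1 F)).
Proof.
apply: full_sub_iso.
apply: (@modif_iso (Ho W_id) D _ _
  (pnat_id (proj1_sig (extend_ob F))) (extend_hom1 (pnat_id (proj1_sig F)))
  (fun X => iso_id (id1 (proj1_sig F X)))).
abstract by move=> X Y f; cbn; rewrite !hcomp_id vcomp1l vcomp1r.
Defined.

Definition extend_hom : psfun (Hom_equiv W D)
  (Hom_equiv (image_family (ho_i W_id) W) D).
Proof.
refine (@Psfun (Hom_equiv W D) (Hom_equiv (image_family (ho_i W_id) W) D)
  extend_ob extend_hom1 (fun F G s t m => extend_modif W_id _ _ m)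
  extend_phi extend_xi _ _ _ _ _ _); intros; apply: modif_eq => U; cbn.
- by [].
- by [].
- abstract by rewrite vcomp1l vcomp1r.
- abstract by rewrite !hcomp_id !vcomp1l !vcomp1r.
- abstract by rewrite !hcomp_id !vcomp1r.
- abstract by rewrite !hcomp_id !vcomp1r.
Defined.

End ExtendHom.

(** * Heterogeneous extensionality principles *)

Lemma iso2_eq (B : bicat) (X Y : B) (f g : hom X Y) (i j : iso2 f g) :
  iso_fwd i = iso_fwd j -> i = j.
Proof.
move=> E; have Ei : i^-1 = j^-1.
  by apply: (iso_mono (i := i)); rewrite iso_invK E iso_invK.
case: i j E Ei => [i i' Ki Ki'] [j j' Kj Kj'] /= E Ei; subst j j'.
by rewrite (proof_irrelevance _ Ki Kj) (proof_irrelevance _ Ki' Kj').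
Qed.

Lemma pnat_eq (C D : bicat) (F G : psfun C D) (s t : pnat F G) :
  (forall X, s X = t X) ->
  (forall (X Y : C) (f : hom X Y), JMeq (iso_fwd (t1 s f)) (iso_fwd (t1 t f))) ->
  s = t.
Proof.
case: s t => [s0 s1 Hs Hs' Hs''] [t0 t1 Ht Ht' Ht''] /= E0 E1.
have {}E0 : s0 = t0 by apply: functional_extensionality_dep.
subst t0.
have {}E1 : s1 = t1.
  do 3!apply: functional_extensionality_dep => ?.
  exact/iso2_eq/JMeq_eq.
subst t1.
by rewrite (proof_irrelevance _ Hs Ht) (proof_irrelevance _ Hs' Ht')
  (proof_irrelevance _ Hs'' Ht'').
Qed.

(** Extending and then restricting returns pseudofunctors that are equal but not convertible to the
    original ones, so their transformations live in different types and are compared by [JMeq]. *)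
Lemma pnat_JMeq (C D : bicat) (F F' G G' : psfun C D) (s : pnat F G)
  (t : pnat F' G') : F = F' -> G = G' ->
  (forall X, JMeq (s X) (t X)) ->
  (forall (X Y : C) (f : hom X Y), JMeq (iso_fwd (t1 s f)) (iso_fwd (t1 t f))) ->
  JMeq s t.
Proof.
move=> EF EG; subst F' G' => E0 E1.
by rewrite (pnat_eq (s := s) (t := t)) // => X; apply: JMeq_eq.
Qed.

Lemma pnat_id_JMeq (C D : bicat) (F F' : psfun C D) :
  F = F' -> JMeq (pnat_id F) (pnat_id F').
Proof. by move=> ->; exact: JMeq_refl. Qed.

Lemma pnat_comp_JMeq (C D : bicat) (F F' G G' H H' : psfun C D)
  (t : pnat G H) (s : pnat F G) (t' : pnat G' H') (s' : pnat F' G') :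
  F = F' -> G = G' -> H = H' -> JMeq t t' -> JMeq s s' ->
  JMeq (pnat_comp t s) (pnat_comp t' s').
Proof.
move=> EF EG EH; subst F' G' H' => Et Es.
by rewrite (JMeq_eq Et) (JMeq_eq Es); exact: JMeq_refl.
Qed.

Lemma modif_JMeq (C D : bicat) (F F' G G' : psfun C D) (s t : pnat F G)
  (s' t' : pnat F' G') (m : modif s t) (n : modif s' t') :
  F = F' -> G = G' -> JMeq s s' -> JMeq t t' ->
  (forall X, JMeq (m X) (n X)) -> JMeq m n.
Proof.
move=> EF EG; subst F' G' => Es Et; have Es' := JMeq_eq Es; have Et' := JMeq_eq Et.
clear Es Et; subst s' t' => E.
by rewrite (modif_eq (m := m) (n := n)) // => X; apply: JMeq_eq.
Qed.

(** Each [JMeq] turns into an equality once the earlier components are substituted, so no transports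
    appear; the axioms agree by proof irrelevance. *)
Lemma psfun_JMeq_eq (A B : bicat) (F G : psfun A B) :
  (forall X, F X = G X) ->
  (forall X Y (f : hom X Y), JMeq (F1 F f) (F1 G f)) ->
  (forall X Y (f g : hom X Y) (a : cell f g), JMeq (F2 F a) (F2 G a)) ->
  (forall X Y Z (g : hom Y Z) (f : hom X Y),
    JMeq (iso_fwd (phi F g f)) (iso_fwd (phi G g f))) ->
  (forall X, JMeq (iso_fwd (xi F X)) (iso_fwd (xi G X))) ->
  F = G.
Proof.
case: F G => [F0 F1 F2 phiF xiF HF1 HF2 HF3 HF4 HF5 HF6].
case=> [G0 G1 G2 phiG xiG HG1 HG2 HG3 HG4 HG5 HG6] /= E0 E1 E2 Ephi Exi.
have {}E0 : F0 = G0 by apply: functional_extensionality_dep.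
subst G0.
have {}E1 : F1 = G1.
  by do 3!apply: functional_extensionality_dep => ?; apply: JMeq_eq.
subst G1.
have {}E2 : F2 = G2.
  by do 5!apply: functional_extensionality_dep => ?; apply: JMeq_eq.
have {}Ephi : phiF = phiG.
  by do 5!apply: functional_extensionality_dep => ?; apply/iso2_eq/JMeq_eq.
have {}Exi : xiF = xiG.
  by apply: functional_extensionality_dep => ?; apply/iso2_eq/JMeq_eq.
subst G2 phiG xiG; f_equal; exact: proof_irrelevance.
Qed.

(** * Extension and restriction are mutually inverse *)

Section Inverse.
Variables (C D : bicat) (W : arrow_family C) (W_id : contains_ids W).

Lemma extend_precomp (F : psfun C D) (HF : maps_into F W (@quasiequivalence D)) :
  psfun_comp (extend W_id HF) (ho_i W_id) = F.
Proof.
apply: psfun_JMeq_eq => *; cbn; rewrite ?ho_eval_of_cell ?F2_id ?vcomp1l //;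
  exact: JMeq_refl.
Qed.

Lemma precomp_extend (H : psfun (Ho W_id) D)
  (HH : maps_into (psfun_comp H (ho_i W_id)) W (@quasiequivalence D)) :
  extend W_id HH = H.
Proof.
apply: psfun_JMeq_eq => *; cbn; rewrite ?ho_eval_precomp ?F2_id ?vcomp1l //;
  exact: JMeq_refl.
Qed.

Lemma extend_hom_i_star :
  psfun_comp (extend_hom D W_id) (ho_i_star W_id D) = psfun_id _.
Proof.
set K := psfun_comp _ _.
have E0 (H : Hom_equiv (image_family (ho_i W_id) W) D) : K H = H.
  by case: H => H ?; apply: subset_eq_compat; apply: precomp_extend.
have E0' H := f_equal (@proj1_sig _ _) (E0 H).
(* The round trip keeps all components of [t]; only its source and target change, along [E0']. *)
have E1 H H' (t : @hom (Hom_equiv (image_family (ho_i W_id) W) D) H H') : JMeq (F1 K t) t.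
  by apply: pnat_JMeq (E0' H) (E0' H') _ _ => *; exact: JMeq_refl.
apply: psfun_JMeq_eq.
- exact: E0.
- exact: E1.
- move=> H H' s t m.
  by apply: modif_JMeq (E0' H) (E0' H') (E1 _ _ s) (E1 _ _ t) _ => X;
    exact: JMeq_refl.
- move=> H H' H'' t s.
  apply: modif_JMeq (E0' H) (E0' H'') _ (E1 _ _ (t ⋅ s)) _.
    exact: pnat_comp_JMeq (E0' H) (E0' H') (E0' H'') (E1 _ _ t) (E1 _ _ s).
  by move=> X; cbn; rewrite vcomp1l; exact: JMeq_refl.
- move=> H.
  (* Both are modifications with identity components, whose sources are the identity transformations
     of the equal pseudofunctors [K H] and [H]. *)
  pose m := iso_fwd (xi K H); pose n := id2 (@id1 (Hom_equiv (image_family (ho_i W_id) W) D) H).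
  have Em U : JMeq (m U) (n U) by cbn; rewrite vcomp1l; exact: JMeq_refl.
  exact (@modif_JMeq _ _ _ _ _ _ _ _ _ _ m n
    (E0' H) (E0' H) (pnat_id_JMeq (E0' H)) (E1 _ _ (id1 H)) Em).
Qed.

Lemma i_star_extend_hom :
  psfun_comp (ho_i_star W_id D) (extend_hom D W_id) = psfun_id _.
Proof.
set K := psfun_comp _ _.
have E0 (F : Hom_equiv W D) : K F = F.
  by case: F => F ?; apply: subset_eq_compat; apply: extend_precomp.
have E0' F := f_equal (@proj1_sig _ _) (E0 F).
have E1 F G (t : @hom (Hom_equiv W D) F G) : JMeq (F1 K t) t.
  by apply: pnat_JMeq (E0' F) (E0' G) _ _ => *; exact: JMeq_refl.
apply: psfun_JMeq_eq.
- exact: E0.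
- exact: E1.
- move=> F G s t m.
  by apply: modif_JMeq (E0' F) (E0' G) (E1 _ _ s) (E1 _ _ t) _ => X;
    exact: JMeq_refl.
- move=> F G H t s.
  apply: modif_JMeq (E0' F) (E0' H) _ (E1 _ _ (t ⋅ s)) _.
    exact: pnat_comp_JMeq (E0' F) (E0' G) (E0' H) (E1 _ _ t) (E1 _ _ s).
  by move=> X; cbn; rewrite vcomp1l; exact: JMeq_refl.
- move=> F.
  pose m := iso_fwd (xi K F); pose n := id2 (@id1 (Hom_equiv W D) F).
  have Em U : JMeq (m U) (n U) by cbn; rewrite vcomp1l; exact: JMeq_refl.
  exact (@modif_JMeq _ _ _ _ _ _ _ _ _ _ m n
    (E0' F) (E0' F) (pnat_id_JMeq (E0' F)) (E1 _ _ (id1 F)) Em).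
Qed.

End Inverse.

(** * From isomorphism to biequivalence *)

Lemma isomorphism_biequivalence (A B : bicat) (F : psfun A B) :
  is_isomorphism F -> is_biequivalence F.
Proof.
(* Rewriting replaces both composites by identity pseudofunctors, so identity transformations
   suffice. *)
case=> G [EA EB]; exists G; rewrite EA EB.
exists (pnat_id _), (pnat_id _).
by split=> X; apply: equivalence_id1.
Qed.

Theorem theorem3p42 :
  forall (C : bicat) (W : arrow_family C) (W_id : contains_ids W) (D : bicat),
    is_biequivalence (ho_i_star W_id D) /\ is_isomorphism (ho_i_star W_id D).
Proof.
move=> C W W_id D.
have iso : is_isomorphism (ho_i_star W_id D).
  exists (extend_hom D W_id); split.
    exact: extend_hom_i_star.
  exact: i_star_extend_hom.
by split=> //; apply: isomorphism_biequivalence.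
Qed.
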